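(* Let $\mathcal H$ be a Hilbert space and let $W\in\mathcal B(\mathcal H\otimes\mathcal H)$ be a multiplicative partial isometry. Consider the subspaces of $\mathcal B(\mathcal H)$ $$\mathcal A:=\operatorname{span}\{(\operatorname{id}\otimes\omega)(W):\omega\in\mathcal B(\mathcal H)_*\},\qquad\widehat{\mathcal A}:=\operatorname{span}\{(\omega\otimes\operatorname{id})(W):\omega\in\mathcal B(\mathcal H)_*\}.$$ Both $\mathcal A$ and $\widehat{\mathcal A}$ are subalgebras of $\mathcal B(\mathcal H)$.
   Context: $\mathcal B(\mathcal H)_*$ is the space of normal functionals on $\mathcal B(\mathcal H)$; the standard leg notation is used. A multiplicative partial isometry is a partial isometry $W\in\mathcal B(\mathcal H\otimes\mathcal H)$ ($WW^*W=W$) such that on $\mathcal H\otimes\mathcal H\otimes\mathcal H$: $W_{23}W_{12}W_{23}^*=W_{12}W_{13}$; $W_{12}^*W_{23}W_{12}=W_{13}W_{23}$; $W_{23}^*W_{23}W_{12}=W_{12}W_{23}^*W_{23}$; $W_{12}W_{12}^*W_{23}=W_{23}W_{12}W_{12}^*$. *)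

(* Defs.v *)
From HB Require Import structures.
From mathcomp Require Import all_boot all_order all_algebra.
From mathcomp Require Import all_classical all_reals.
From mathcomp Require Import topology normedtype sequences.
From mathcomp Require Import complex ring lra.

Set Implicit Arguments.
Unset Strict Implicit.
Unset Printing Implicit Defensive.

Import Order.TTheory GRing.Theory Num.Theory numFieldNormedType.Exports.

Local Open Scope classical_set_scope.
Local Open Scope ring_scope.

Reserved Notation "''B(' H , K )" (at level 8, H at level 9, format "''B(' H ,  K )").
Reserved Notation "''B(' H )" (at level 8, format "''B(' H )").
Reserved Notation "⟨ x , y ⟩" (at level 0, format "⟨ x ,  y ⟩").
Reserved Notation "T ^†" (at level 1, format "T ^†").
Reserved Notation "x ⊗ y" (at level 40, left associativity).

Definition lspan (K : pzRingType) (V : lmodType K) (S : set V) : set V :=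
  [set x | exists n (c : 'I_n -> K) (v : 'I_n -> V),
     (forall i, S (v i)) /\ x = \sum_(i < n) c i *: v i].

(* The inner product is linear in its first variable. *)
HB.mixin Record CompleteNormedModule_isHilbert (R : realType) H
    of CompleteNormedModule R[i] H := {
  hdot : H -> H -> R[i];
  hdot_linear : forall z, linear_for *%R (hdot^~ z);
  hdotC : forall x y, hdot y x = (hdot x y)^*;
  hdot_norm : forall x, hdot x x = `|x| ^+ 2
}.

#[short(type="hilbertType")]
HB.structure Definition Hilbert (R : realType) :=
  { H of CompleteNormedModule_isHilbert R H & CompleteNormedModule R[i] H }.

Notation "⟨ x , y ⟩" := (hdot x y) : ring_scope.

Section BoundedOperators.
Context {R : realType}.
Implicit Types H K L : hilbertType R.

Definition bounded_op H K : {pred H -> K} := fun f : H -> K =>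
  `[< linear f /\ exists M : R[i], forall x, `|f x| <= M * `|x| >].

Record bop H K := BOp { bop_fun :> H -> K; bopP : bop_fun \in @bounded_op H K }.

HB.instance Definition _ H K := [isSub for @bop_fun H K].
HB.instance Definition _ H K := [Choice of bop H K by <:].

Fact bounded_op_submod H K : submod_closed (@bounded_op H K).
Proof.
split.
  apply/asboolP; split; last by exists 0 => x; rewrite normr0 mul0r.
  by move=> a x y; rewrite -[LHS]/(0 : K) -[RHS]/(a *: (0 : K) + 0) scaler0 addr0.
move=> a f g /asboolP[lf [M fM]] /asboolP[lg [N gN]]; apply/asboolP; split.
  move=> b x y; rewrite -[LHS]/(a *: f (b *: x + y) + g (b *: x + y)).
  rewrite -[RHS]/(b *: (a *: f x + g x) + (a *: f y + g y)) lf lg.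
  by rewrite !scalerDr !scalerA (mulrC a b) addrACA.
exists (`|a| * M + N) => x; rewrite mulrDl.
rewrite -[leLHS]/(`|a *: f x + g x|) (le_trans (ler_normD _ _))// lerD//.
by rewrite normrZ -mulrA ler_wpM2l.
exact: gN.
Qed.

HB.instance Definition _ H K :=
  GRing.isSubmodClosed.Build _ _ (@bounded_op H K) (bounded_op_submod H K).
HB.instance Definition _ H K := [SubChoice_isSubLmodule of bop H K by <:].


Lemma bop_linear H K (T : bop H K) : linear T.
Proof. by case: T => f /= /asboolP[]. Qed.

HB.instance Definition _ H K (T : bop H K) :=
  GRing.isLinear.Build R[i] H K *:%R T (bop_linear T).

Lemma bop_bounded H K (T : bop H K) :
  exists2 M, 0 <= M & forall x, `|T x| <= M * `|x|.
Proof.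
case: T => f /= /asboolP[_ [M fM]]; exists `|M| => // x.
have [->|x0] := eqVneq x 0; first by rewrite (le_trans (fM 0))// normr0 !mulr0.
have Mx := le_trans (normr_ge0 _) (fM x).
have M0 : 0 <= M by rewrite -(pmulr_lge0 M (x := `|x|)) ?normr_gt0.
by rewrite ger0_norm.
Qed.

Lemma bopE H K (S T : bop H K) : S =1 T -> S = T.
Proof. by move=> ST; apply: val_inj; apply/funext. Qed.

Fact id_bounded H : idfun \in @bounded_op H H.
Proof. by apply/asboolP; split=> //; exists 1 => x; rewrite mul1r. Qed.

Fact comp_bounded H K L (S : bop K L) (T : bop H K) : S \o T \in @bounded_op H L.
Proof.
apply/asboolP; split; first by move=> a x y; rewrite /= !linearP.
have [M M0 SM] := bop_bounded S; have [N N0 TN] := bop_bounded T.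
exists (M * N) => x /=; rewrite (le_trans (SM _))// -mulrA ler_wpM2l//.
Qed.

Definition bop_id H : bop H H := BOp (@id_bounded H).
Definition bop_comp H K L (S : bop K L) (T : bop H K) : bop H L :=
  BOp (comp_bounded S T).

Fact bop_compA H : associative (@bop_comp H H H).
Proof. by move=> A B C; exact: bopE. Qed.
Fact bop_comp1l H : left_id (@bop_id H) (@bop_comp H H H).
Proof. by move=> A; exact: bopE. Qed.
Fact bop_comp1r H : right_id (@bop_id H) (@bop_comp H H H).
Proof. by move=> A; exact: bopE. Qed.
Fact bop_compDl H : left_distributive (@bop_comp H H H) +%R.
Proof. by move=> A B C; exact: bopE. Qed.
Fact bop_compDr H : right_distributive (@bop_comp H H H) +%R.
Proof. by move=> A B C; apply: bopE => x /=; rewrite linearD. Qed.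

HB.instance Definition _ H := GRing.Zmodule_isPzRing.Build (bop H H)
  (@bop_compA H) (@bop_comp1l H) (@bop_comp1r H) (@bop_compDl H) (@bop_compDr H).

End BoundedOperators.

Notation "''B(' H , K )" := (bop H K) : type_scope.
Notation "''B(' H )" := (bop H H) : type_scope.

Section HilbertTheory.
Context {R : realType}.
Implicit Types H K L : hilbertType R.

Lemma hdotDl H (x y z : H) : ⟨x + y, z⟩ = ⟨x, z⟩ + ⟨y, z⟩.
Proof. by have := hdot_linear z 1 x y; rewrite scale1r mul1r. Qed.

Lemma hdot0l H (z : H) : ⟨0, z⟩ = 0.
Proof. by apply: (addrI ⟨0, z⟩); rewrite -hdotDl !addr0. Qed.

Lemma hdotZl H a (x z : H) : ⟨a *: x, z⟩ = a * ⟨x, z⟩.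
Proof. by have := hdot_linear z a x 0; rewrite hdot0l !addr0. Qed.

Lemma hdotNl H (x z : H) : ⟨- x, z⟩ = - ⟨x, z⟩.
Proof. by rewrite -scaleN1r hdotZl mulN1r. Qed.

Lemma hdotBl H (x y z : H) : ⟨x - y, z⟩ = ⟨x, z⟩ - ⟨y, z⟩.
Proof. by rewrite hdotDl hdotNl. Qed.

Lemma hdotDr H (x y z : H) : ⟨z, x + y⟩ = ⟨z, x⟩ + ⟨z, y⟩.
Proof. by rewrite hdotC hdotDl rmorphD/= -!hdotC. Qed.

Lemma hdotZr H a (x z : H) : ⟨z, a *: x⟩ = a^* * ⟨z, x⟩.
Proof. by rewrite hdotC hdotZl rmorphM/= -hdotC. Qed.

Lemma hdot0r H (z : H) : ⟨z, 0⟩ = 0.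
Proof. by rewrite hdotC hdot0l conjC0. Qed.

Lemma hdotNr H (x z : H) : ⟨z, - x⟩ = - ⟨z, x⟩.
Proof. by rewrite hdotC hdotNl rmorphN/= -hdotC. Qed.

Lemma hdotBr H (x y z : H) : ⟨z, x - y⟩ = ⟨z, x⟩ - ⟨z, y⟩.
Proof. by rewrite hdotDr hdotNr. Qed.

Lemma hdot_suml H I (r : seq I) (P : pred I) (F : I -> H) z :
  ⟨\sum_(i <- r | P i) F i, z⟩ = \sum_(i <- r | P i) ⟨F i, z⟩.
Proof. exact: (big_morph (hdot^~ z) (fun x y => hdotDl x y z) (hdot0l z)). Qed.

Lemma hdot_sumr H I (r : seq I) (P : pred I) (F : I -> H) z :
  ⟨z, \sum_(i <- r | P i) F i⟩ = \sum_(i <- r | P i) ⟨z, F i⟩.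
Proof. exact: (big_morph (hdot z) (fun x y => hdotDr x y z) (hdot0r z)). Qed.

Lemma hdot_injl H (x y : H) : (forall z, ⟨x, z⟩ = ⟨y, z⟩) -> x = y.
Proof.
move=> xy; apply/eqP; rewrite -subr_eq0 -normr_eq0 -sqrf_eq0.
by rewrite -hdot_norm hdotBl xy subrr.
Qed.

Lemma hdot_CS H (x y : H) : `|⟨x, y⟩| <= `|x| * `|y|.
Proof.
have [->|y0] := eqVneq y 0; first by rewrite hdot0r !normr0 mulr0.
have ny : `|y| != 0 by rewrite normr_eq0.
pose a := ⟨x, y⟩ / `|y| ^+ 2.
have o : ⟨x - a *: y, y⟩ = 0.
  by rewrite hdotBl hdotZl hdot_norm divfK ?subrr ?expf_neq0.
have : 0 <= ⟨x - a *: y, x - a *: y⟩ by rewrite hdot_norm exprn_ge0.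
rewrite hdotBr hdotZr o mulr0 subr0 hdotBl hdotZl hdot_norm subr_ge0.
rewrite (hdotC x y) /a mulrAC -normCK.
rewrite ler_pdivrMr ?exprn_gt0 ?normr_gt0// -exprMn ler_sqr ?nnegrE//.
by rewrite mulr_ge0.
Qed.

Lemma hilbert_complete H (u : nat -> H) :
  (forall e : R, 0 < e -> exists N, forall n m, (N <= n)%N -> (N <= m)%N ->
     `|u n - u m| < e%:C%C) ->
  exists l, forall e : R, 0 < e -> exists N, forall n, (N <= n)%N ->
     `|l - u n| < e%:C%C.
Proof.
move=> uC.
have /cauchy_cvgP/cvg_ex[l ul] : cauchy (u @ \oo).
  apply: cauchy_exP => e e0.
  have er : (complex.Re e)%:C%C = e by rewrite RRe_real// gtr0_real.
  have [|N NP] := uC (complex.Re e); first by rewrite -ltcR er.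
  exists (u N); exists N => // n /= Nn.
  by rewrite -ball_normE /= -er NP.
exists l => e e0; have eC : 0 < e%:C%C by rewrite ltcR.
by move/cvgrPdist_lt : ul => /(_ _ eC)[N _ NP]; exists N.
Qed.

Lemma dense_approx H (S : set H) : dense S ->
  forall x (e : R), 0 < e -> exists2 s, S s & `|x - s| < e%:C%C.
Proof.
move=> dS x e e0; have eC : 0 < e%:C%C by rewrite ltcR.
have [|y [xy Sy]] := dS (ball x e%:C%C) _ (ball_open _ _).
  by exists x; exact: ballxx.
by exists y => //; move: xy; rewrite -ball_normE.
Qed.

Let rcM (a b : R) : (a * b)%:C%C = a%:C%C * b%:C%C.
Proof. exact: rmorphM. Qed.

Let rcD (a b : R) : (a + b)%:C%C = a%:C%C + b%:C%C.
Proof. exact: rmorphD. Qed.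

Let rcN (a : R) : (- a)%:C%C = - a%:C%C.
Proof. exact: rmorphN. Qed.

Let rcX (a : R) n : (a ^+ n)%:C%C = a%:C%C ^+ n.
Proof. exact: rmorphXn. Qed.

Let Re_rcM (a : R) z : complex.Re (a%:C%C * z) = a * complex.Re z.
Proof. by case: z => x y /=; rewrite mul0r subr0. Qed.

Let rn H (x : H) : R := complex.Re `|x|.

Let rnE H (x : H) : `|x| = (rn x)%:C%C.
Proof. by rewrite /rn RRe_real// normr_real. Qed.

Let rn_ge0 H (x : H) : 0 <= rn x.
Proof. by rewrite -ler0c -rnE normr_ge0. Qed.

Let rn2E H (x : H) : (rn x ^+ 2)%:C%C = ⟨x, x⟩.
Proof. by rewrite rmorphXn/= -rnE hdot_norm. Qed.

Let rnD2 H (x y : H) :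
  rn (x + y) ^+ 2 = rn x ^+ 2 + rn y ^+ 2 + 2 * complex.Re ⟨y, x⟩.
Proof.
have e : ⟨y, x⟩ + ⟨x, y⟩ = (complex.Re ⟨y, x⟩)%:C%C + (complex.Re ⟨y, x⟩)%:C%C.
  by rewrite (hdotC y x) -[_^*]/(conjc _) addcJ mulr2n mulrDl mul1r.
apply: (@complexI R); rewrite mulr2n mulrDl mul1r !rmorphD/= -e.
rewrite !rn2E hdotDr !hdotDl; ring.
Qed.

Let rnZ H a (x : H) : rn (a *: x) = complex.Re `|a| * rn x.
Proof.
apply: (@complexI R); rewrite -rnE normrZ rcM -rnE RRe_real//.
exact: normr_real.
Qed.

Lemma exists_invn (e : R) : 0 < e -> exists N, forall n, (N <= n)%N -> n.+1%:R^-1 < e.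
Proof.
move=> e0; exists (Num.truncn e^-1) => n Nn.
rewrite invf_plt ?posrE// (lt_le_trans (truncnS_gt _))// ler_nat ltnS//.
Qed.

Lemma riesz H (f : H -> R[i]) (M : R[i]) : linear_for *%R f ->
  (forall x, `|f x| <= M * `|x|) -> exists y, forall x, f x = ⟨x, y⟩.
Proof.
move=> flin fM.
have fD x y : f (x + y) = f x + f y.
  by have := flin 1 x y; rewrite scale1r mul1r.
have f0 : f 0 = 0 by apply: (addrI (f 0)); rewrite -fD !addr0.
have fZ a x : f (a *: x) = a * f x.
  by have := flin a x 0; rewrite f0 !addr0.
pose J x := rn x ^+ 2 - 2 * complex.Re (f x).
have JD x y : J (x + y) = J x + rn y ^+ 2 + 2 * complex.Re (⟨y, x⟩ - f y).
  rewrite /J rnD2 fD !raddfD/= raddfN/=; ring.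
have rnB2 x y : rn (x - y) ^+ 2 = 2 * rn x ^+ 2 + 2 * rn y ^+ 2 - rn (x + y) ^+ 2.
  by rewrite !rnD2 hdotNl raddfN/= /rn normrN; ring.
have Jmid x y : J x + J y - 2 * J ((2^-1)%:C%C *: (x + y)) = rn (x - y) ^+ 2 / 2.
  have n2 : complex.Re `|(2^-1 : R)%:C%C| = 2^-1.
    by rewrite ger0_norm// ler0c invr_ge0.
  rewrite rnB2 /J rnZ n2 fZ fD Re_rcM [complex.Re (f x + f y)]raddfD/=.
  by field.
have Jlb x : - (complex.Re M) ^+ 2 <= J x.
  have : complex.Re (f x) <= complex.Re M * rn x.
    have := le_trans (normc_ge_Re (f x)) (fM x); rewrite rnE mulrC lecE Re_rcM.
    by move=> /andP[_] /= h; rewrite mulrC; exact: le_trans (ler_norm _) h.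
  by rewrite /J => h; have := sqr_ge0 (rn x - complex.Re M); lra.
pose m := inf (range J).
have Jinf : has_inf (range J).
  split; first by exists (J 0); exists 0.
  by exists (- (complex.Re M) ^+ 2) => _ [x _ <-].
have Jm x : m <= J x by apply: ge_inf; [case: Jinf|exists x].
have Jex n : exists x, J x < m + n.+1%:R^-1.
  have [|_ [x _ <-] xm] := inf_adherent (eps := n.+1%:R^-1) _ Jinf.
    by rewrite invr_gt0.
  by exists x.
have [u uJ] := choice Jex.
have [y uy] : exists l, forall e : R, 0 < e -> exists N, forall n, (N <= n)%N ->
     `|l - u n| < e%:C%C.
  apply: hilbert_complete => e e0.
  have [N NP] := exists_invn (e := e ^+ 2 / 4) ltac:(by rewrite divr_gt0 ?exprn_gt0).
  exists N => n k Nn Nk; rewrite rnE ltcR -ltr_sqr ?nnegrE ?(ltW e0)//.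
  have := Jmid (u n) (u k); have := Jm ((2^-1)%:C%C *: (u n + u k)).
  have := uJ n; have := uJ k; have := NP _ Nn; have := NP _ Nk.
  move: (k.+1%:R^-1) (n.+1%:R^-1) (J _) (J _) (J _) (rn _ ^+ 2) (e ^+ 2) (m).
  move=> /= a b c d f' g h i; lra.
exists y => z; apply/eqP; rewrite eq_sym -subr_eq0 -normr_eq0; apply/negPn/negP => D0.
pose D := complex.Re `|⟨z, y⟩ - f z|.
have DE : `|⟨z, y⟩ - f z| = D%:C%C by rewrite /D RRe_real// normr_real.
have {}D0 : 0 < D.
  by rewrite -ltcR -DE lt_def D0 normr_ge0.
pose s := (1 + rn z ^+ 2)^-1.
have s0 : 0 < s by rewrite invr_gt0 ltr_pwDl// sqr_ge0.
have s1 : s * rn z ^+ 2 <= 1.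
  by rewrite mulrC ler_pdivrMr ?mul1r ?lerDr// ltr_pwDl// sqr_ge0.
have key n : s * complex.Re `|⟨z, u n⟩ - f z| ^+ 2 < n.+1%:R^-1.
  set G := ⟨z, u n⟩ - f z; set g := complex.Re `|G|.
  have gE : `|G| = g%:C%C by rewrite /g RRe_real// normr_real.
  have := Jm (u n + - (s%:C%C * G^* ) *: z); rewrite JD hdotZl fZ -mulrBr -/G.
  have -> : - (s%:C%C * G^* ) * G = (- (s * g ^+ 2))%:C%C.
    rewrite mulNr -mulrA [_^* * _]mulrC -normCK gE.
    by rewrite rcN rcM rcX.
  rewrite rnZ normrN normrM norm_conjC gE ger0_norm ?ler0c ?(ltW s0)//.
  rewrite -rcM exprMn /= => h.
  have : (s * g) ^+ 2 * rn z ^+ 2 <= s * g ^+ 2.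
    have := ler_wpM2l (mulr_ge0 (ltW s0) (sqr_ge0 g)) s1.
    by rewrite mulr1; apply: le_trans; rewrite le_eqVlt; apply/orP; left; apply/eqP; ring.
  have := uJ n; move: h.
  move: (n.+1%:R^-1) ((s * g) ^+ 2 * _) (s * g ^+ 2) (J _) (m) => /= a b c d e; lra.
have [N NP] := uy (D / 2 / (1 + rn z)) ltac:(by rewrite !divr_gt0// ltr_pwDl).
have [N' N'P] := exists_invn (e := s * (D / 2) ^+ 2)
  ltac:(by rewrite mulr_gt0// exprn_gt0// divr_gt0).
pose n := maxn N N'.
have := N'P n (leq_maxr _ _); apply/negP; rewrite -leNgt.
apply: le_trans (ltW (key n)); rewrite ler_pM2l// ler_sqr ?nnegrE.
- have : `|⟨z, y⟩ - f z| <= `|⟨z, u n⟩ - f z| + `|⟨z, y - u n⟩|.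
    have -> : ⟨z, y⟩ - f z = (⟨z, u n⟩ - f z) + ⟨z, y - u n⟩ by rewrite hdotBr; ring.
    exact: ler_normD.
  have : `|⟨z, y - u n⟩| <= (D / 2)%:C%C.
    apply: le_trans (hdot_CS _ _) _.
    have /ltW/(ler_wpM2l (normr_ge0 z)) := NP n (leq_maxl _ _).
    move=> /le_trans; apply; rewrite rnE -rcM lecR.
    rewrite mulrA ler_pdivrMr ?ltr_pwDl// mulrDr mulr1 mulrC lerDr.
    by rewrite divr_ge0// ltW.
  rewrite DE => h1 h2; have := le_trans h2 (lerD (lexx _) h1).
  rewrite -[X in X + _]RRe_real ?normr_real// -rcD lecR; lra.
- by rewrite divr_ge0// ltW.
- by rewrite -ler0c RRe_real// normr_real.
Qed.

End HilbertTheory.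

Section Span.
Context {K : pzRingType} {V : lmodType K}.
Implicit Types S : set V.

Lemma lspan0 S : lspan S 0.
Proof. by exists 0%N, (fun=> 0), (fun=> 0); split=> [[]|]//; rewrite big_ord0. Qed.

Lemma lspan_sub S : S `<=` lspan S.
Proof.
move=> x Sx; exists 1%N, (fun=> 1), (fun=> x); split=> //.
by rewrite big_ord1 scale1r.
Qed.

Lemma lspanP S a x y : lspan S x -> lspan S y -> lspan S (a *: x + y).
Proof.
move=> [n [c [v [Sv ->]]]] [m [d [w [Sw ->]]]].
exists (n + m)%N.
exists (fun k => match fintype.split k with inl i => a * c i | inr j => d j end).
exists (fun k => match fintype.split k with inl i => v i | inr j => w j end); split.
  by move=> k; case: fintype.split.
rewrite big_split_ord/= scaler_sumr; congr (_ + _); apply: eq_bigr => i _.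
  by rewrite scalerA -[lshift _ _]/(unsplit (inl i)) unsplitK.
by rewrite -[rshift _ _]/(unsplit (inr i)) unsplitK.
Qed.

Lemma lspan_min S (P : set V) : P 0 ->
  (forall a x y, P x -> P y -> P (a *: x + y)) -> S `<=` P -> lspan S `<=` P.
Proof.
move=> P0 PP SP _ [n [c [v [Sv ->]]]].
elim/big_ind : _ => //.
  by move=> x y Px Py; rewrite -[x]scale1r; exact: PP.
by move=> i _; rewrite -[_ *: _]addr0; apply: PP => //; exact/SP/Sv.
Qed.

End Span.

Section Approximation.
Context {R : realType}.
Implicit Types H K L : hilbertType R.

Let approx H (S : set H) (x : H) :=
  forall e : R, 0 < e -> exists2 s, S s & `|x - s| < e%:C%C.

Lemma approx_dense H (S : set H) : (forall x, approx S x) -> dense S.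
Proof.
move=> aS O [x Ox] oO.
have /nbhs_ballP[e /= e0 eO] : nbhs x O by exact: open_nbhs_nbhs.
have er : (complex.Re e)%:C%C = e by rewrite RRe_real// gtr0_real.
have [|s Ss xs] := aS x (complex.Re e); first by rewrite -ltcR er.
by exists s; split=> //; apply: eO; rewrite -ball_normE /= -er.
Qed.

Let norm_re (V : normedModType R[i]) (x : V) : `|x| = (complex.Re `|x|)%:C%C.
Proof. by rewrite RRe_real// normr_real. Qed.

Let normC_re (a : R[i]) : `|a| = (complex.Re `|a|)%:C%C.
Proof. by rewrite RRe_real// normr_real. Qed.

Let lin_est H a (x y s t : H) (e : R) : 0 < e ->
  `|x - s| < (e / 2 / (1 + complex.Re `|a|))%:C%C -> `|y - t| < (e / 2)%:C%C ->
  `|(a *: x + y) - (a *: s + t)| < e%:C%C.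
Proof.
move=> e0; set r := complex.Re `|a| => xs yt.
have rE : `|a| = r%:C%C by rewrite /r RRe_real// normr_real.
have r0 : 0 <= r by rewrite -ler0c -rE.
rewrite opprD addrACA -scalerBr (le_lt_trans (ler_normD _ _))// normrZ.
rewrite [ltRHS](_ : _ = (e / 2)%:C%C + (e / 2)%:C%C); last first.
  by rewrite -rmorphD/= -splitr.
rewrite ler_ltD//; apply: le_trans (ler_wpM2l (normr_ge0 a) (ltW xs)) _.
rewrite rE -rmorphM lecR mulrA ler_pdivrMr ?ltr_pwDl// mulrDr mulr1 mulrC.
by rewrite lerDr divr_ge0// ltW.
Qed.

Let est_gt0 (a : R[i]) (e : R) : 0 < e -> 0 < e / 2 / (1 + complex.Re `|a|).
Proof.
move=> e0; by rewrite !divr_gt0// ltr_pwDl// -ler0c -normC_re normr_ge0.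
Qed.

Lemma approx_lin H (S : set H) a x y :
  approx (lspan S) x -> approx (lspan S) y -> approx (lspan S) (a *: x + y).
Proof.
move=> ax ay e e0.
have [|s Ss xs] := ax (e / 2 / (1 + complex.Re `|a|)); first exact: est_gt0.
have [|t St yt] := ay (e / 2); first by rewrite divr_gt0.
by exists (a *: s + t); [exact: lspanP|exact: lin_est].
Qed.

Lemma bop_extend H K I (e : I -> H) (f : I -> K) (M : R[i]) :
  dense (lspan (range e)) ->
  (forall p : H * K, lspan (range (fun i => (e i, f i))) p -> `|p.2| <= M * `|p.1|) ->
  exists S : 'B(H, K), forall i, S (e i) = f i.
Proof.
move=> /dense_approx de efM.
set G := lspan _ in efM.
have fstG u : lspan (range e) u -> exists v, G (u, v).
  move=> [n [c [w [ew ->]]]].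
  have /choice[j jw] : forall k, exists i, e i = w k.
    by move=> k; have [i _ <-] := ew k; exists i.
  exists (\sum_(k < n) c k *: f (j k)).
  exists n, c, (fun k => (e (j k), f (j k))); split; first by move=> k; exists (j k).
  rewrite [RHS]surjective_pairing; congr pair.
    rewrite (big_morph fst (fun _ _ => erefl) erefl).
    by apply: eq_bigr => k _; rewrite -jw.
  by rewrite (big_morph snd (fun _ _ => erefl) erefl).
pose r := complex.Re `|M|.
have r0 : 0 <= r by rewrite -ler0c -normC_re.
have Gr p : G p -> `|p.2| <= r%:C%C * `|p.1|.
  move=> Gp; rewrite -normC_re; have := efM _ Gp => h.
  have := le_trans (normr_ge0 _) h => /ger0_norm h'.
  by move: h; rewrite -h' normrM normr_id.
pose Gbar x v := forall d : R, 0 < d ->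
  exists p, [/\ G p, `|x - p.1| < d%:C%C & `|v - p.2| < d%:C%C].
have GbarM x v : Gbar x v -> `|v| <= r%:C%C * `|x|.
  move=> xv; rewrite (norm_re v) (norm_re x) -rmorphM lecR.
  apply/ler_addgt0Pr => d d0.
  have [|p [Gp xp vp]] := xv (d / (r + 1)); first by rewrite divr_gt0// ltr_wpDl.
  set d' := d / (r + 1) in xp vp.
  have h1 : `|v| <= `|p.2| + d'%:C%C.
    rewrite -[v in leLHS](subrK p.2) addrC (le_trans (ler_normD _ _))//.
    by rewrite lerD2l ltW.
  have h2 : `|p.1| <= `|x| + d'%:C%C.
    rewrite -[p.1 in leLHS](subrK x) addrC (le_trans (ler_normD _ _))//.
    by rewrite lerD2l distrC ltW.
  have h3 : `|v| <= r%:C%C * (`|x| + d'%:C%C) + d'%:C%C.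
    rewrite (le_trans h1)// lerD2r (le_trans (Gr _ Gp))// ler_wpM2l// ler0c//.
  move: h3; rewrite (norm_re v) (norm_re x) -rmorphD -rmorphM -rmorphD lecR.
  move=> /le_trans; apply; rewrite mulrDr -addrA lerD2l -{2}[d'](mul1r) -mulrDl.
  by rewrite /d' mulrC divfK// gt_eqF// ltr_wpDl.
have GbarL a x y v w : Gbar x v -> Gbar y w -> Gbar (a *: x + y) (a *: v + w).
  move=> xv yw d d0.
  have [|p [Gp xp vp]] := xv (d / 2 / (1 + complex.Re `|a|)); first exact: est_gt0.
  have [|q [Gq yq wq]] := yw (d / 2); first by rewrite divr_gt0.
  exists (a *: p + q); split; first exact: lspanP.
  - exact: lin_est.
  - exact: lin_est.
have GbarU x v w : Gbar x v -> Gbar x w -> v = w.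
  move=> xv xw; have := GbarM _ _ (GbarL (- 1) _ _ _ _ xv xw).
  rewrite !scaleN1r addNr normr0 mulr0 addrC normr_le0 subr_eq0.
  by move=> /eqP.
have GbarE x : exists v, Gbar x v.
  have /choice[p pP] : forall n, exists p, G p /\ `|x - p.1| < (n.+1%:R^-1 : R)%:C%C.
    move=> n; have [|s es xs] := de x n.+1%:R^-1; first by rewrite invr_gt0.
    by have [v Gv] := fstG _ es; exists (s, v).
  have [|v vP] := @hilbert_complete R K (fun n => (p n).2).
    move=> d d0; pose d' := d / 2 / (1 + r).
    have d'0 : 0 < d' by rewrite !divr_gt0// ltr_pwDl.
    have [N NP] := exists_invn d'0; exists N => n m Nn Nm.
    have xp k : (N <= k)%N -> `|x - (p k).1| < d'%:C%C.
      by move=> /NP h; rewrite (lt_trans (pP k).2)// ltcR.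
    have Gnm : G (- 1 *: p m + p n) by apply: lspanP; [exact: (pP m).1|exact: (pP n).1].
    have -> : (p n).2 - (p m).2 = (- 1 *: p m + p n).2.
      by rewrite scaleN1r addrC.
    apply: le_lt_trans (Gr _ Gnm) _.
    have -> : (- 1 *: p m + p n).1 = (x - (p m).1) - (x - (p n).1).
      by rewrite scaleN1r/= opprB [RHS]addrC addrA subrK addrC.
    have h : `|x - (p m).1 - (x - (p n).1)| <= (d' + d')%:C%C.
      by rewrite rmorphD (le_trans (ler_normB _ _))// lerD// ltW// xp.
    have r0C : 0 <= r%:C%C by rewrite ler0c.
    apply: le_lt_trans (ler_wpM2l r0C h) _.
    rewrite -rmorphM ltcR -mulrDl -splitr mulrA ltr_pdivrMr ?ltr_pwDl//.
    by rewrite mulrC mulrDr mulr1 ltrDr.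
  exists v => d d0; have [N NP] := exists_invn d0; have [N' N'P] := vP _ d0.
  exists (p (maxn N N')); split; first exact: (pP _).1.
    by rewrite (lt_trans (pP _).2)// ltcR NP// leq_maxl.
  by rewrite N'P// leq_maxr.
have [S SP] := choice GbarE.
have SB : S \in @bounded_op R H K.
  apply/asboolP; split; last by exists r%:C%C => x; exact: GbarM.
  by move=> a x y; apply: GbarU (SP _) (GbarL _ _ _ _ _ (SP x) (SP y)).
exists (BOp SB) => i /=; apply: GbarU (SP _) _ => d d0.
exists (e i, f i); rewrite !subrr !normr0 ltcR; split=> //.
by apply: lspan_sub; exists i.
Qed.

End Approximation.

Section Adjoint.
Context {R : realType}.
Implicit Types H K L : hilbertType R.

Lemma sesqui_bop H K (s : H -> K -> R[i]) (M : R[i]) : 0 <= M ->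
  (forall y, linear_for *%R (s^~ y)) ->
  (forall x a y z, s x (a *: y + z) = a^* * s x y + s x z) ->
  (forall x y, `|s x y| <= M * `|x| * `|y|) ->
  exists S : 'B(H, K), forall x y, ⟨S x, y⟩ = s x y.
Proof.
move=> M0 sl sr sM.
have rep x : exists v, forall y, ⟨v, y⟩ = s x y.
  have [||v vP] := @riesz R K (fun y => (s x y)^*) (M * `|x|).
  - by move=> a y z; rewrite sr rmorphD/= rmorphM/= conjCK.
  - by move=> y; rewrite norm_conjC.
  by exists v => y; rewrite hdotC -vP conjCK.
have [S SP] := choice rep.
suff SB : S \in @bounded_op R H K by exists (BOp SB).
apply/asboolP; split.
  by move=> a x y; apply: hdot_injl => z; rewrite hdotDl hdotZl !SP sl.
exists M => x; have [->|Sx] := eqVneq (S x) 0; first by rewrite normr0 mulr_ge0.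
have Sx0 : 0 < `|S x| by rewrite normr_gt0.
rewrite -(ler_pM2r Sx0) -expr2 -hdot_norm SP (le_trans _ (sM _ _))//.
by rewrite -SP hdot_norm ger0_norm// exprn_ge0.
Qed.

Definition adj H K (T : 'B(H, K)) : 'B(K, H) :=
  xget 0 [set S : 'B(K, H) | forall x y, ⟨T x, y⟩ = ⟨x, S y⟩].

Lemma adjP H K (T : 'B(H, K)) x y : ⟨T x, y⟩ = ⟨x, adj T y⟩.
Proof.
rewrite /adj; case: xgetP => [S _ //|] none.
have [M M0 TM] := bop_bounded T.
have [||||S SP] := @sesqui_bop K H (fun y x => ⟨y, T x⟩) M.
- by [].
- by move=> {}x a u v; rewrite hdotDl hdotZl.
- by move=> {}y a u v; rewrite linearP hdotDr hdotZr.
- move=> {}y {}x; apply: (le_trans (hdot_CS _ _)).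
  by rewrite mulrAC [leRHS]mulrC ler_wpM2l.
by have := none S; case=> u v; rewrite hdotC -SP -hdotC.
Qed.

End Adjoint.

Notation "T ^†" := (adj T) : ring_scope.

(* A realisation of the Hilbert space tensor product of H and K: up to a unique
   unitary compatible with [tens], the completion of the algebraic one. *)
Record hilbertTensor (R : realType) (H K : hilbertType R) := HilbertTensor {
  tens_space :> hilbertType R;
  tens : H -> K -> tens_space;
  tens_linearl : forall y, linear (tens^~ y);
  tens_linearr : forall x, linear (tens x);
  hdot_tens : forall x x' y y', ⟨tens x y, tens x' y'⟩ = ⟨x, x'⟩ * ⟨y, y'⟩;
  tens_dense : dense (lspan [set tens p.1 p.2 | p in [set: H * K]])
}.
Arguments tens {R H K h}.

Notation "x ⊗ y" := (tens x y) : ring_scope.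

Section Tensor.
Context {R : realType}.
Implicit Types H K L : hilbertType R.

Lemma tensDl H K (T : hilbertTensor H K) x x' y :
  (x + x') ⊗ y = x ⊗ y + x' ⊗ y :> T.
Proof. by have := tens_linearl T y 1 x x'; rewrite !scale1r. Qed.

Lemma tens0l H K (T : hilbertTensor H K) y : 0 ⊗ y = 0 :> T.
Proof. by apply: (addrI (0 ⊗ y : T)); rewrite -tensDl !addr0. Qed.

Lemma tensZl H K (T : hilbertTensor H K) a x y :
  (a *: x) ⊗ y = a *: (x ⊗ y) :> T.
Proof. by have := tens_linearl T y a x 0; rewrite tens0l !addr0. Qed.

Lemma tensDr H K (T : hilbertTensor H K) x y y' :
  x ⊗ (y + y') = x ⊗ y + x ⊗ y' :> T.
Proof. by have := tens_linearr T x 1 y y'; rewrite !scale1r. Qed.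

Lemma tens0r H K (T : hilbertTensor H K) x : x ⊗ 0 = 0 :> T.
Proof. by apply: (addrI (x ⊗ 0 : T)); rewrite -tensDr !addr0. Qed.

Lemma tensZr H K (T : hilbertTensor H K) a x y :
  x ⊗ (a *: y) = a *: (x ⊗ y) :> T.
Proof. by have := tens_linearr T x a y 0; rewrite tens0r !addr0. Qed.

Lemma tens_suml H K (T : hilbertTensor H K) I (r : seq I) (P : pred I) F y :
  (\sum_(i <- r | P i) F i) ⊗ y = \sum_(i <- r | P i) F i ⊗ y :> T.
Proof.
exact: (big_morph (fun x => x ⊗ y : T) (fun x x' => tensDl T x x' y) (tens0l T y)).
Qed.

Lemma tens_sumr H K (T : hilbertTensor H K) I (r : seq I) (P : pred I) F x :
  x ⊗ (\sum_(i <- r | P i) F i) = \sum_(i <- r | P i) x ⊗ F i :> T.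
Proof.
exact: (big_morph (fun y => x ⊗ y : T) (fun y y' => tensDr T x y y') (tens0r T x)).
Qed.

Lemma norm_tens H K (T : hilbertTensor H K) x y : `|x ⊗ y : T| = `|x| * `|y|.
Proof.
apply/eqP; rewrite -(eqrXn2 (n := 2%N)) ?mulr_ge0//.
by rewrite -hdot_norm hdot_tens !hdot_norm exprMn.
Qed.

Lemma gram_schmidt K n (y : 'I_n -> K) :
  exists m (f : 'I_m -> K) (a : 'I_n -> 'I_m -> R[i]),
    (forall i j, ⟨f i, f j⟩ = (i == j)%:R) /\
    forall i, y i = \sum_j a i j *: f j.
Proof.
elim: n y => [|n IH] y.
  by exists 0%N, (fun=> 0), (fun _ _ => 0); split; case.
have [m [f [a [ff yf]]]] := IH (fun i => y (lift ord0 i)).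
pose b j := ⟨y ord0, f j⟩; pose r := y ord0 - \sum_j b j *: f j.
have rf j : ⟨r, f j⟩ = 0.
  rewrite hdotBl hdot_suml (bigD1 j)//= big1 ?addr0.
    by rewrite hdotZl ff eqxx mulr1 subrr.
  by move=> i /negPf ij; rewrite hdotZl ff ij mulr0.
have [r0|r0] := eqVneq r 0.
  exists m, f, (fun i j => oapp (a^~ j) (b j) (unlift ord0 i)); split=> // i.
  case: (unliftP ord0 i) => [i' ->|->]; rewrite /= ?yf//.
  by apply/eqP; rewrite -subr_eq0; exact/eqP.
have nr : `|r| != 0 by rewrite normr_eq0.
exists m.+1, (fun j => oapp f (`|r|^-1 *: r) (unlift ord0 j)).
exists (fun i j => oapp (fun j' => oapp (a^~ j') (b j') (unlift ord0 i))
   (if unlift ord0 i is Some _ then 0 else `|r|) (unlift ord0 j)).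
split=> [i j|i].
  case: (unliftP ord0 i) => [i' ->|->]; case: (unliftP ord0 j) => [j' ->|->] /=.
  - by rewrite ff (inj_eq lift_inj).
  - by rewrite hdotZr hdotC rf conjC0 mulr0.
  - by rewrite hdotZl rf mulr0.
  - rewrite hdotZl hdotZr hdot_norm fmorphV/= conj_Creal ?normr_real// expr2.
    by rewrite mulKf// mulVf.
rewrite big_ord_recl unlift_none /=.
case: (unliftP ord0 i) => [i' ->|->] /=.
  by rewrite scale0r add0r yf; apply: eq_bigr => j _; rewrite liftK.
under eq_bigr do rewrite liftK /=.
by rewrite scalerA mulfV// scale1r subrK.
Qed.

Definition tens_swap H K (T : hilbertTensor H K) : hilbertTensor K H.
Proof.
refine (@HilbertTensor R K H T (fun y x => x ⊗ y)
  (@tens_linearr _ _ _ T) (@tens_linearl _ _ _ T) _ _).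
  by move=> y y' x x'; rewrite hdot_tens mulrC.
suff -> : [set (p.2 ⊗ p.1 : T) | p in [set: K * H]] =
  [set p.1 ⊗ p.2 | p in [set: H * K]] by exact: tens_dense.
by apply/seteqP; split=> _ [[u v] _ <-]; exists (v, u).
Defined.

Lemma ampl_ex H K (T : hilbertTensor H K) (A : 'B(H)) :
  exists S : 'B(T), forall x y, S (x ⊗ y) = A x ⊗ y.
Proof.
have [M M0 AM] := bop_bounded A.
have [||S SP] := @bop_extend R T T (H * K)%type (fun p => p.1 ⊗ p.2)
  (fun p => A p.1 ⊗ p.2) M; last by exists S => x y; exact: (SP (x, y)).
  exact: tens_dense.
move=> _ [n [c [v [vP ->]]]].
have /choice[p pv] : forall k, exists p : H * K, (p.1 ⊗ p.2, A p.1 ⊗ p.2) = v k.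
  by move=> k; have [p _ <-] := vP k; exists p.
have [m [f [a [ff yf]]]] := gram_schmidt (fun k => (p k).2).
pose z j := \sum_k (a k j * c k) *: (p k).1.
have red (B : 'B(H)) : \sum_k c k *: (B (p k).1 ⊗ (p k).2) = \sum_j B (z j) ⊗ f j :> T.
  under eq_bigr do rewrite yf tens_sumr scaler_sumr.
  rewrite exchange_big; apply: eq_bigr => j _ /=.
  rewrite /z linear_sum tens_suml; apply: eq_bigr => k _.
  by rewrite tensZr (linearZ_LR B) tensZl scalerA mulrC.
have nrm (w : 'I_m -> H) : `|\sum_j w j ⊗ f j : T| ^+ 2 = \sum_j `|w j| ^+ 2.
  rewrite -hdot_norm hdot_suml; apply: eq_bigr => j _.
  rewrite hdot_sumr (bigD1 j)//= big1 ?addr0.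
    by rewrite hdot_tens ff eqxx mulr1 hdot_norm.
  by move=> i /negPf ij; rewrite hdot_tens ff eq_sym ij mulr0.
rewrite (big_morph fst (fun _ _ => erefl) erefl).
rewrite (big_morph snd (fun _ _ => erefl) erefl).
rewrite [X in _ <= _ * `|X|](eq_bigr (fun k => c k *: ((1 : 'B(H)) (p k).1 ⊗ (p k).2 : T))); last first.
  by move=> k _; rewrite -pv.
rewrite [X in `|X| <= _](eq_bigr (fun k => c k *: (A (p k).1 ⊗ (p k).2 : T)));
  last by move=> k _; rewrite -pv.
rewrite !red -ler_sqr ?nnegrE ?mulr_ge0// exprMn !nrm mulr_sumr.
by apply: ler_sum => j _; rewrite -exprMn ler_sqr ?nnegrE ?mulr_ge0.
Qed.

Definition tensop H K (T : hilbertTensor H K) (A : 'B(H)) (B : 'B(K)) : 'B(T) :=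
  xget 0 [set S : 'B(T) | forall x y, S (x ⊗ y) = A x ⊗ B y].

Lemma tensopE H K (T : hilbertTensor H K) A B x y :
  tensop T A B (x ⊗ y) = A x ⊗ B y.
Proof.
rewrite /tensop; case: xgetP => [S _ //|] none.
have [S1 S1P] := ampl_ex T A; have [S2 S2P] := ampl_ex (tens_swap T) B.
have := none ((S1 : 'B(T)) * S2); case=> u v.
by rewrite -[LHS]/(S1 (S2 (u ⊗ v))) (S2P v u) S1P.
Qed.

Lemma isometry_ex H K I (e : I -> H) (f : I -> K) :
  dense (lspan (range e)) -> (forall i j, ⟨f i, f j⟩ = ⟨e i, e j⟩) ->
  exists S : 'B(H, K), forall i, S (e i) = f i.
Proof.
move=> de fe; apply: (bop_extend (M := 1) de) => _ [n [c [v [vP ->]]]].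
have /choice[p pv] : forall k, exists p, (e p, f p) = v k.
  by move=> k; have [p _ <-] := vP k; exists p.
rewrite (big_morph fst (fun _ _ => erefl) erefl).
rewrite (big_morph snd (fun _ _ => erefl) erefl) mul1r.
rewrite -ler_sqr ?nnegrE// -!hdot_norm !hdot_suml le_eqVlt; apply/orP; left.
apply/eqP/eq_bigr => i _; rewrite !hdot_sumr; apply: eq_bigr => j _.
by rewrite -!pv !hdotZl !hdotZr fe.
Qed.

Definition flip H (T : hilbertTensor H H) : 'B(T) :=
  xget 0 [set S : 'B(T) | forall x y, S (x ⊗ y) = y ⊗ x].

Lemma flipE H (T : hilbertTensor H H) x y : flip T (x ⊗ y) = y ⊗ x.
Proof.
rewrite /flip; case: xgetP => [S _ //|] none.
have [||S SP] := @isometry_ex T T (H * H)%type (fun p => p.1 ⊗ p.2)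
  (fun p => p.2 ⊗ p.1).
- exact: tens_dense.
- by move=> p q; rewrite !hdot_tens mulrC.
by have := none S; case=> u v; exact: (SP (u, v)).
Qed.

End Tensor.

Section Legs.
Context {R : realType} {H : hilbertType R}.
(* H2 stands for H ⊗ H and H3 for H ⊗ H ⊗ H = (H ⊗ H) ⊗ H. *)
Context {H2 : hilbertTensor H H} (H3 : hilbertTensor H2 H).

Lemma tens3_dense : dense (lspan
  [set ((p.1.1 ⊗ p.1.2 : H2) ⊗ p.2 : H3) | p in [set: H * H * H]]).
Proof.
set S := (X in lspan X).
pose P (w : H3) := forall e : R, 0 < e -> exists2 s, lspan S s & `|w - s| < e%:C%C.
have PS w : lspan S w -> P w by move=> Sw e e0; exists w; rewrite // subrr normr0 ltcR.
have Pt (u : H2) z : P (u ⊗ z).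
  move=> e e0; pose r := complex.Re `|z|.
  have rE : `|z| = r%:C%C by rewrite /r RRe_real// normr_real.
  have r0 : 0 <= r by rewrite -ler0c -rE.
  have [|v sv uv] := dense_approx (@tens_dense _ _ _ H2) u (e := e / (1 + r)).
    by rewrite divr_gt0// ltr_pwDl.
  exists (v ⊗ z).
    apply: (lspan_min (P := fun v => lspan S (v ⊗ z)) _ _ _ sv).
    - by rewrite tens0l; exact: lspan0.
    - by move=> a x y Sx Sy; rewrite tens_linearl; exact: lspanP.
    - by move=> _ [[x y] _ <-]; apply: lspan_sub; exists (x, y, z).
  rewrite -scaleN1r -tensZl scaleN1r -tensDl norm_tens.
  apply: le_lt_trans (ler_wpM2r (normr_ge0 z) (ltW uv)) _.
  rewrite rE -rmorphM ltcR mulrAC ltr_pdivrMr ?ltr_pwDl// mulrDr mulr1.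
  by rewrite ltrDr.
apply: approx_dense => w e e0.
have e20 : 0 < e / 2 by rewrite divr_gt0.
have [t tP wt] := dense_approx (@tens_dense _ _ _ H3) w e20.
have [s Ss ts] : exists2 s, lspan S s & `|t - s| < (e / 2)%:C%C.
  apply: (lspan_min (P := P) _ _ _ tP) => //.
  - by apply: PS; exact: lspan0.
  - by move=> a x y; exact: approx_lin.
  - by move=> _ [[x y] _ <-]; exact: Pt.
exists s => //; rewrite (splitr e) rmorphD -(subrK t w) -addrA.
by rewrite (le_lt_trans (ler_normD _ _))// ltrD.
Qed.

Definition flip23 : 'B(H3) :=
  xget 0 [set S : 'B(H3) | forall x y z : H,
    S ((x ⊗ y : H2) ⊗ z) = (x ⊗ z : H2) ⊗ y].

Lemma flip23E x y z : flip23 ((x ⊗ y : H2) ⊗ z) = (x ⊗ z : H2) ⊗ y.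
Proof.
rewrite /flip23; case: xgetP => [S _ //|] none.
have [|S SP] := isometry_ex (f := fun p => (p.1.1 ⊗ p.2 : H2) ⊗ p.1.2 : H3)
  tens3_dense.
  by move=> p q; rewrite !hdot_tens mulrAC.
by have := none S; case=> u v w; exact: (SP (u, v, w)).
Qed.

Definition flip12 : 'B(H3) := tensop H3 (flip H2) 1.

Definition leg12 (W : 'B(H2)) : 'B(H3) := tensop H3 W 1.
Definition leg13 (W : 'B(H2)) : 'B(H3) := flip23 * leg12 W * flip23.
Definition leg23 (W : 'B(H2)) : 'B(H3) := flip12 * leg13 W * flip12.

Record multiplicative_partial_isometry (W : 'B(H2)) : Prop := {
  mpi_partial_isometry : W * W^† * W = W;
  mpi_pentagon : leg23 W * leg12 W * (leg23 W)^† = leg12 W * leg13 W;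
  mpi_pentagon' : (leg12 W)^† * leg23 W * leg12 W = leg13 W * leg23 W;
  mpi_comm23 : (leg23 W)^† * leg23 W * leg12 W = leg12 W * (leg23 W)^† * leg23 W;
  mpi_comm12 : leg12 W * (leg12 W)^† * leg23 W = leg23 W * leg12 W * (leg12 W)^†
}.

End Legs.

Section NormalFunctionals.
Context {R : realType} {H : hilbertType R}.

Definition square_summable (xi : nat -> H) : Prop :=
  exists M : R[i], forall n, \sum_(k < n) `|xi k| ^+ 2 <= M.

(* phi T = \sum_k ⟨T (xi k), eta k⟩ with square-summable xi and eta; the series
   always converges, and these functionals generate the sigma-weak topology. *)
Definition sigma_weak_generator (phi : 'B(H) -> R[i]) : Prop :=
  exists xi eta : nat -> H, [/\ square_summable xi, square_summable eta &
    forall T : 'B(H),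
      series (fun k => ⟨T (xi k), eta k⟩ : R[i]^o) @ \oo --> (phi T : R[i]^o)].

(* Continuity at 0, hence everywhere by linearity, for the sigma-weak topology. *)
Definition normal_functional (omega : {scalar 'B(H)}) : Prop :=
  forall e : R[i], 0 < e -> exists n (phi : 'I_n -> 'B(H) -> R[i]) (d : R[i]),
    [/\ 0 < d, forall i, sigma_weak_generator (phi i) &
        forall T : 'B(H), (forall i, `|phi i T| < d) -> `|omega T| < e].

Lemma sigma_weak_generator_bounded phi : sigma_weak_generator phi ->
  exists2 c : R[i], 0 <= c & forall (T : 'B(H)) (N e : R[i]), 0 <= N -> 0 < e ->
    (forall x, `|T x| <= N * `|x|) -> `|phi T| < N * c + e.
Proof.
move=> [xi [eta [[M xiM] [M' etaM] phiP]]].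
have M0 : 0 <= M by have := xiM 0; rewrite big_ord0.
have M'0 : 0 <= M' by have := etaM 0; rewrite big_ord0.
exists (M + M'); first exact: addr_ge0.
move=> T N e N0 e0 TN.
have /cvgrPdist_lt/(_ _ e0)[n _ /(_ n (leqnn n))/= ne] := phiP T.
set s := series _ _ in ne.
rewrite -(subrK s (phi T)) addrC (le_lt_trans (ler_normD _ _))// ler_ltD//.
rewrite /s seriesEnat/= big_mkord (le_trans (ler_norm_sum _ _ _))//.
apply: (@le_trans _ _ (\sum_(k < n) N * (`|xi k| ^+ 2 + `|eta k| ^+ 2))); last first.
  rewrite -mulr_sumr big_split/= ler_wpM2l//.
  by apply: lerD; [exact: xiM|exact: etaM].
apply: ler_sum => k _; rewrite (le_trans (hdot_CS _ _))//.
apply: (@le_trans _ _ (N * (`|xi k| * `|eta k|))).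
  by rewrite mulrA ler_wpM2r.
rewrite ler_wpM2l// -subr_ge0.
have -> : `|xi k| ^+ 2 + `|eta k| ^+ 2 - `|xi k| * `|eta k| =
  (`|xi k| - `|eta k|) ^+ 2 + `|xi k| * `|eta k| by ring.
apply: addr_ge0; last exact: mulr_ge0.
by rewrite real_exprn_even_ge0// realB// normr_real.
Qed.

Lemma normal_bounded omega : normal_functional omega ->
  exists2 c : R[i], 0 <= c & forall (T : 'B(H)) (N : R[i]), 0 <= N ->
    (forall x, `|T x| <= N * `|x|) -> `|omega T| <= c * N.
Proof.
move=> /(_ 1 ltr01)[n [phi [d [d0 phiP dP]]]].
have /choice[c cP] : forall i, exists c : R[i], 0 <= c /\
    forall (T : 'B(H)) (N e : R[i]), 0 <= N -> 0 < e ->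
    (forall x, `|T x| <= N * `|x|) -> `|phi i T| < N * c + e.
  by move=> i; have [c c0 cP] := sigma_weak_generator_bounded (phiP i); exists c.
pose C := 1 + \sum_i c i.
have C0 : 0 < C by rewrite ltr_pwDl// sumr_ge0// => i _; exact: (cP i).1.
pose del := d / 2 / C.
have del0 : 0 < del by rewrite !divr_gt0.
have small (T : 'B(H)) : (forall x, `|T x| <= del * `|x|) -> `|omega T| < 1.
  move=> Tdel; apply: dP => i.
  have d20 : 0 < d / 2 by rewrite divr_gt0.
  have := (cP i).2 T del _ (ltW del0) d20 Tdel => /lt_le_trans; apply.
  rewrite [leRHS]splitr lerD2r /del -mulrA; apply: ler_piMr; first exact: ltW.
  rewrite mulrC ler_pdivrMr// mul1r /C (bigD1 i)//= addrCA lerDl addr_ge0//.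
  by rewrite sumr_ge0// => j _; exact: (cP j).1.
exists del^-1; first by rewrite invr_ge0 ltW.
move=> T N; rewrite le_eqVlt => /predU1P[<- T0|N0 TN].
  have -> : T = 0.
    apply: bopE => x; apply/eqP; rewrite -normr_le0.
    by have := T0 x; rewrite mul0r.
  by rewrite linear0 normr0 mulr0.
have : `|omega ((del / N) *: T)| < 1.
  apply: small => x; rewrite -[bop_fun _ x]/((del / N) *: T x) normrZ ger0_norm.
    rewrite -mulrA; apply: ler_wpM2l; first exact: ltW.
    by rewrite mulrC ler_pdivrMr// mulrC.
  by rewrite divr_ge0// ltW.
rewrite linearZ/= normrM ger0_norm; last by rewrite divr_ge0// ltW.
by rewrite mulrAC ltr_pdivrMr// mul1r => h; rewrite mulrC ler_pdivlMr// mulrC ltW.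
Qed.

End NormalFunctionals.

Section Slices.
Context {R : realType}.
Implicit Types H K : hilbertType R.

Fact tensl_bounded H K (T : hilbertTensor H K) x :
  (fun y => x ⊗ y) \in @bounded_op R K T.
Proof.
apply/asboolP; split; first exact: tens_linearr.
by exists `|x| => y; rewrite norm_tens.
Qed.

Fact tensr_bounded H K (T : hilbertTensor H K) y :
  (fun x => x ⊗ y) \in @bounded_op R H T.
Proof.
apply/asboolP; split; first exact: tens_linearl.
by exists `|y| => x; rewrite norm_tens mulrC.
Qed.

Definition tensl H K (T : hilbertTensor H K) (x : H) : 'B(K, T) :=
  BOp (tensl_bounded T x).
Definition tensr H K (T : hilbertTensor H K) (y : K) : 'B(H, T) :=
  BOp (tensr_bounded T y).

(* (ω_{xi, eta} ⊗ id)(X) and (id ⊗ ω_{xi, eta})(X) for the vector functional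
   ω_{xi, eta} = ⟨_ xi, eta⟩ *)
Definition vslice_l H K (T : hilbertTensor H K) (xi eta : H) (X : 'B(T)) : 'B(K) :=
  bop_comp (tensl T eta)^† (bop_comp X (tensl T xi)).
Definition vslice_r H K (T : hilbertTensor H K) (xi eta : K) (X : 'B(T)) : 'B(H) :=
  bop_comp (tensr T eta)^† (bop_comp X (tensr T xi)).

Lemma vslice_lP H K (T : hilbertTensor H K) xi eta X y y' :
  ⟨vslice_l xi eta X y, y'⟩ = ⟨X (xi ⊗ y), (eta ⊗ y' : T)⟩.
Proof. by rewrite hdotC -adjP -hdotC. Qed.

Lemma vslice_rP H K (T : hilbertTensor H K) xi eta X x x' :
  ⟨vslice_r xi eta X x, x'⟩ = ⟨X (x ⊗ xi), (x' ⊗ eta : T)⟩.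
Proof. by rewrite hdotC -adjP -hdotC. Qed.

(* (id ⊗ omega)(X), determined by
   ω_{xi, eta}((id ⊗ omega)(X)) = omega((ω_{xi, eta} ⊗ id)(X)) *)
Definition slice_r H K (T : hilbertTensor H K) (omega : {scalar 'B(K)})
    (X : 'B(T)) : 'B(H) :=
  xget 0 [set S : 'B(H) |
    forall xi eta, ⟨S xi, eta⟩ = omega (vslice_l xi eta X)].

(* (omega ⊗ id)(X) *)
Definition slice_l H K (T : hilbertTensor H K) (omega : {scalar 'B(H)})
    (X : 'B(T)) : 'B(K) :=
  xget 0 [set S : 'B(K) |
    forall xi eta, ⟨S xi, eta⟩ = omega (vslice_r xi eta X)].

Lemma slice_ex H K (T : hilbertTensor H K) (omega : {scalar 'B(K)}) (X : 'B(T)) :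
  normal_functional omega ->
  exists S : 'B(H), forall xi eta, ⟨S xi, eta⟩ = omega (vslice_l xi eta X).
Proof.
move=> /normal_bounded[c c0 cP]; have [M M0 XM] := bop_bounded X.
apply: (@sesqui_bop _ _ _ _ (c * M)).
- exact: mulr_ge0.
- move=> eta a x y; rewrite -[RHS](linearP omega); congr (omega _).
  apply: bopE => z; apply: hdot_injl => w.
  rewrite -[bop_fun (_ + _) z]/(a *: vslice_l x eta X z + vslice_l y eta X z).
  by rewrite hdotDl hdotZl !vslice_lP tens_linearl linearP hdotDl hdotZl.
- move=> x a y z; rewrite -[RHS](linearP omega); congr (omega _).
  apply: bopE => u; apply: hdot_injl => w.
  rewrite -[bop_fun (_ + _) u]/(a^* *: vslice_l x y X u + vslice_l x z X u).
  by rewrite hdotDl hdotZl !vslice_lP tens_linearl hdotDr hdotZr.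
- move=> x y.
  have N0 : 0 <= M * `|x| * `|y| by rewrite !mulr_ge0.
  rewrite -!mulrA; apply: cP; first by rewrite mulrA.
  move=> z; set w := vslice_l x y X z.
  have [->|w0] := eqVneq w 0; first by rewrite normr0 mulr_ge0// mulrA.
  have nw : 0 < `|w| by rewrite normr_gt0.
  rewrite -(ler_pM2r nw) -expr2 -hdot_norm vslice_lP.
  apply: (@le_trans _ _ `|⟨X (x ⊗ z), y ⊗ w⟩|).
    by rewrite -vslice_lP hdot_norm ger0_norm// exprn_ge0.
  rewrite (le_trans (hdot_CS _ _))// norm_tens.
  have := XM (x ⊗ z); rewrite norm_tens => /(ler_wpM2r _) h.
  apply: le_trans (h (`|y| * `|w|) _) _; first by rewrite mulr_ge0.
  by rewrite le_eqVlt; apply/orP; left; apply/eqP; ring.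
Qed.

Lemma slice_rP H K (T : hilbertTensor H K) (omega : {scalar 'B(K)}) (X : 'B(T)) :
  normal_functional omega ->
  forall xi eta, ⟨slice_r omega X xi, eta⟩ = omega (vslice_l xi eta X).
Proof.
move=> nomega xi eta; rewrite /slice_r; case: xgetP => [S _ //|] none.
by have [S SP] := slice_ex X nomega; have := none S; case=> u v.
Qed.

Lemma slice_lP H K (T : hilbertTensor H K) (omega : {scalar 'B(H)}) (X : 'B(T)) :
  normal_functional omega ->
  forall xi eta, ⟨slice_l omega X xi, eta⟩ = omega (vslice_r xi eta X).
Proof.
move=> nomega xi eta; rewrite /slice_l; case: xgetP => [S _ //|] none.
have [S SP] := @slice_ex _ _ (tens_swap T) omega X nomega.
have := none S; case=> u v; rewrite SP; congr (omega _).
apply: bopE => z; apply: hdot_injl => w.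
by apply: etrans (vslice_lP _ _ _ _ _) _; apply/esym/vslice_rP.
Qed.

End Slices.

(* Not required to be unital. *)
Definition is_subalgebra (R : realType) (H : hilbertType R) (A : set 'B(H)) : Prop :=
  [/\ A 0, forall (a : R[i]) S T, A S -> A T -> A (a *: S + T) &
      forall S T, A S -> A T -> A (S * T)].

(* Main.v *)
(* For normal functionals omega and omega', the pentagon equation gives
     (id ⊗ omega)(W) (id ⊗ omega')(W) = (id ⊗ omega ⊗ omega')(W_12 W_13)
       = (id ⊗ omega ⊗ omega')(W_23 W_12 W_23^†) = (id ⊗ theta)(W)
   with theta(A) = (omega ⊗ omega')(W (A ⊗ 1) W^†), and the second pentagon
   equation gives the same for the left slices with W^† (1 ⊗ A) W in place of
   W (A ⊗ 1) W^†.  The point is that theta is again normal.  A sigma-weakly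
   continuous functional is a linear combination of finitely many of the series
   generating the topology, hence is itself such a series; so theta is a double
   series of functionals A |-> ⟨(A ⊗ 1) u, v⟩, and each of these is a series of
   vector functionals whose square sums are controlled by the norms of u and v. *)
Require Import Defs.
From HB Require Import structures.
From mathcomp Require Import all_boot all_order all_algebra.
From mathcomp Require Import all_classical all_reals.
From mathcomp Require Import topology normedtype sequences complex.
From mathcomp Require Import ring lra.

Set Implicit Arguments.
Unset Strict Implicit.
Unset Printing Implicit Defensive.

Import Order.TTheory GRing.Theory Num.Theory numFieldNormedType.Exports.

Local Open Scope classical_set_scope.
Local Open Scope ring_scope.

(** * Absolutely summable double series, summed along an enumeration of pairs *)

Section DoubleSeries.
Context {R : realType}.

(* Indices that encode no pair contribute [0]. *)
Definition decode_seq (V : zmodType) (f : nat -> nat -> V) (n : nat) : V :=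
  oapp (fun p => f p.1 p.2) 0 (pickle_inv n : option (nat * nat)).

Definition decoded (n : nat) : seq (nat * nat) := pmap pickle_inv (iota 0 n).

Lemma decoded_uniq n : uniq (decoded n).
Proof.
rewrite /decoded; apply: (pmap_uniq (g := pickle)); last exact: iota_uniq.
exact: pickle_invK.
Qed.

Lemma mem_decoded n p : (pickle p < n)%N -> p \in decoded n.
Proof.
move=> pn; rewrite mem_pmap; apply/mapP; exists (pickle p); last by rewrite pickleK_inv.
by rewrite mem_iota.
Qed.

Lemma sum_decode_seq (V : zmodType) (f : nat -> nat -> V) n :
  \sum_(k < n) decode_seq f k = \sum_(p <- decoded n) f p.1 p.2.
Proof. by rewrite /decoded big_pmap -[in RHS](subn0 n) -/(index_iota 0 n) big_mkord. Qed.

Lemma le_sum_uniq_seq (I : eqType) (F F' : seq I) (g : I -> R[i]) :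
  (forall p, 0 <= g p) -> uniq F -> uniq F' -> {subset F <= F'} ->
  \sum_(p <- F) g p <= \sum_(p <- F') g p.
Proof.
move=> g0 uF uF' FF'; rewrite [leRHS](bigID (mem F))/=.
have -> : \sum_(p <- F' | p \in F) g p = \sum_(p <- F) g p.
  rewrite -big_filter; apply: perm_big; apply: uniq_perm => //.
    exact: filter_uniq.
  by move=> p; rewrite mem_filter andb_idr//; exact: FF'.
by rewrite lerDl sumr_ge0.
Qed.

Definition rectangle m n : seq (nat * nat) := [seq (i, j) | i <- iota 0 m, j <- iota 0 n].

Lemma rectangle_uniq m n : uniq (rectangle m n).
Proof. by apply: allpairs_uniq; rewrite ?iota_uniq// => -[a b] [c d]. Qed.

Lemma mem_rectangle m n p : (p \in rectangle m n) = (p.1 < m)%N && (p.2 < n)%N.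
Proof.
apply/allpairsP/andP.
  by move=> [[a b] /= [am bn ->]]; move: am bn; rewrite !mem_iota.
by move=> [pm pn]; exists p; rewrite !mem_iota; split=> //; case: p {pm pn}.
Qed.

Lemma sum_rectangle (V : zmodType) (f : nat -> nat -> V) m n :
  \sum_(p <- rectangle m n) f p.1 p.2 = \sum_(i < m) \sum_(j < n) f i j.
Proof.
rewrite big_allpairs_dep /= -[in LHS](subn0 m) -/(index_iota 0 m) big_mkord.
by apply: eq_bigr => i _; rewrite -[in LHS](subn0 n) -/(index_iota 0 n) big_mkord.
Qed.

Lemma sub_rectangle (F : seq (nat * nat)) :
  exists K, forall m n, (K <= m)%N -> (K <= n)%N -> {subset F <= rectangle m n}.
Proof.
exists (\max_(p <- F) (p.1 + p.2).+1) => m n Km Kn p pF; rewrite mem_rectangle.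
have : ((p.1 + p.2).+1 <= \max_(p <- F) (p.1 + p.2).+1)%N by exact: leq_bigmax_seq.
move=> h; apply/andP; split.
  by apply: leq_trans (leq_trans h Km); rewrite ltnS leq_addr.
by apply: leq_trans (leq_trans h Kn); rewrite ltnS leq_addl.
Qed.

Lemma sub_decoded (F : seq (nat * nat)) :
  exists K, forall n, (K <= n)%N -> {subset F <= decoded n}.
Proof.
exists (\max_(p <- F) (pickle p).+1) => n Kn p pF; apply: mem_decoded.
by apply: leq_trans Kn; exact: leq_bigmax_seq.
Qed.

(* The supremum of the finite sums of absolute values is nearly attained on some
   finite set, and adding indices to that set changes the sum of [t] very little. *)
Lemma abs_summable_cauchy (I : eqType) (t : I -> R[i]) (G e : R[i]) :
  (forall F, uniq F -> \sum_(p <- F) `|t p| <= G) -> 0 < e ->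
  exists2 F0, uniq F0 & forall F, uniq F -> {subset F0 <= F} ->
    `|\sum_(p <- F) t p - \sum_(p <- F0) t p| < e.
Proof.
move=> tG e0.
pose s (F : seq I) : R := complex.Re (\sum_(p <- F) `|t p|).
have sE F : \sum_(p <- F) `|t p| = (s F)%:C%C.
  by rewrite RRe_real// ger0_real// sumr_ge0.
have eE : e = (complex.Re e)%:C%C by rewrite RRe_real// gtr0_real.
have e0' : 0 < complex.Re e by rewrite -ltcR -eE.
have GE : G = (complex.Re G)%:C%C.
  by rewrite RRe_real// ger0_real// (le_trans _ (tG [::] _))// big_nil.
have sup : has_sup [set s F | F in [set F | uniq F]].
  split; first by exists (s [::]); exists [::].
  by exists (complex.Re G) => _ [F /= uF <-]; rewrite -lecR -sE -GE tG.
have [_ [F0 /= uF0 <-] F0e] := sup_adherent e0' sup.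
exists F0 => // F uF FF0.
have sub (g : I -> R[i]) : \sum_(p <- F) g p - \sum_(p <- F0) g p =
    \sum_(p <- F | p \notin F0) g p.
  rewrite [X in X - _](bigID (mem F0))/=.
  suff -> : \sum_(p <- F | p \in F0) g p = \sum_(p <- F0) g p by rewrite addrAC subrr add0r.
  rewrite -big_filter; apply: perm_big; apply: uniq_perm => //.
    exact: filter_uniq.
  by move=> p; rewrite mem_filter andb_idr//; exact: FF0.
rewrite sub (le_lt_trans (ler_norm_sum _ _ _))// -sub !sE -rmorphB eE ltcR.
have : s F <= reals.sup [set s F | F in [set F | uniq F]].
  by apply: ub_le_sup; [case: sup|exists F].
move: F0e; rewrite /=; lra.
Qed.

(** A finite set [F0] carries all but a small part of the double sum. Long partial sums along the
    enumeration and large rectangular sums both contain it, hence are close, and rectangles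
    approximate the iterated limit [l]. *)
Lemma cvg_decode_series (t : nat -> nat -> R[i]) (s : nat -> R[i]) (l G : R[i]) :
  (forall F : seq (nat * nat), uniq F -> \sum_(p <- F) `|t p.1 p.2| <= G) ->
  (forall k, series (t k : nat -> R[i]^o) @ \oo --> (s k : R[i]^o)) ->
  series (s : nat -> R[i]^o) @ \oo --> (l : R[i]^o) ->
  series (decode_seq t : nat -> R[i]^o) @ \oo --> (l : R[i]^o).
Proof.
move=> tG ts sl; apply/cvgrPdist_lt => e e0.
have e40 : 0 < e / 4%:R by rewrite divr_gt0.
have [F0 uF0 F0P] := abs_summable_cauchy (t := fun p => t p.1 p.2) tG e40.
have [K KP] := sub_rectangle F0; have [N NP] := sub_decoded F0.
move/cvgrPdist_lt : sl => /(_ _ e40)[m0 _ m0P].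
(* The number of rows [m] is fixed first, leaving finitely many row series; the number of columns
   [n'] is chosen afterwards, depending on [m]. *)
pose m := maxn K m0.
have /cvgrPdist_lt/(_ _ e40)[n0 _ n0P] :
    (fun n => \sum_(k < m) series (t k : nat -> R[i]^o) n : R[i]^o) @ \oo -->
    (\sum_(k < m) s k : R[i]^o).
  by apply: cvg_big => [|k _]; [exact: add_continuous|exact: ts].
exists N => // n /= Nn; pose n' := maxn K n0.
have h1 := F0P _ (decoded_uniq n) (NP _ Nn).
have h2 := F0P _ (rectangle_uniq m n') (KP m n' (leq_maxl _ _) (leq_maxl _ _)).
have h3 := m0P m (leq_maxr _ _); have h4 := n0P n' (leq_maxr _ _).
have h4' : \sum_(k < m) series (t k : nat -> R[i]^o) n' = \sum_(k < m) \sum_(j < n') t k j.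
  by apply: eq_bigr => k _; rewrite seriesEnat /= big_mkord.
move: h1 h2 h3 h4; rewrite /= h4' !seriesEnat /= !big_mkord.
rewrite sum_decode_seq sum_rectangle.
set a := \sum_(p <- decoded n) _; set b := \sum_(p <- F0) _.
set c := \sum_(k < m) \sum_(j < n') _; set d := \sum_(k < m) s k.
move=> h1 h2 h3 h4.
have -> : l - a = (l - d) + (d - c) + (c - b) - (a - b) by ring.
have -> : e = e / 4%:R + e / 4%:R + e / 4%:R + e / 4%:R by field.
rewrite (le_lt_trans (ler_normB _ _))// ltrD//.
rewrite (le_lt_trans (ler_normD _ _))// ltrD//.
by rewrite (le_lt_trans (ler_normD _ _))// ltrD.
Qed.

Lemma sum_seq_pairs_le (g : nat -> nat -> R[i]) (a : nat -> R[i]) (M : R[i])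
    (F : seq (nat * nat)) :
  (forall k i, 0 <= g k i) -> (forall k n, \sum_(i < n) g k i <= a k) ->
  (forall n, \sum_(k < n) a k <= M) -> uniq F -> \sum_(p <- F) g p.1 p.2 <= M.
Proof.
move=> g0 ga aM uF; have [K KP] := sub_rectangle F.
apply: le_trans (le_trans _ (aM K)).
  apply: (le_sum_uniq_seq (F' := rectangle K K)) => //; first exact: rectangle_uniq.
  exact: KP.
by rewrite sum_rectangle; apply: ler_sum => k _.
Qed.

End DoubleSeries.

(** * Generators of the sigma-weak topology, with explicit bounds *)

Section Generators.
Context {R : realType}.
Implicit Types H K : hilbertType R.

(** The bounds on the square sums are recorded because summing a series of generators requires
    control of the sums of these bounds. *)
Definition sigma_weak_le H (a b : R[i]) (phi : 'B(H) -> R[i]) : Prop :=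
  exists xi eta : nat -> H,
  [/\ forall n, \sum_(k < n) `|xi k| ^+ 2 <= a,
      forall n, \sum_(k < n) `|eta k| ^+ 2 <= b &
      forall T : 'B(H),
        series (fun k => ⟨T (xi k), eta k⟩ : R[i]^o) @ \oo --> (phi T : R[i]^o)].

Lemma sigma_weak_leP H (phi : 'B(H) -> R[i]) :
  sigma_weak_generator phi <-> exists a b, sigma_weak_le a b phi.
Proof.
split.
  by move=> [xi [eta [[a xia] [b etab] phiP]]]; exists a, b, xi, eta.
by move=> [a [b [xi [eta [xia etab phiP]]]]]; exists xi, eta; split => //; [exists a|exists b].
Qed.

Lemma sigma_weak_le_trans H (a b a' b' : R[i]) (phi : 'B(H) -> R[i]) :
  a <= a' -> b <= b' -> sigma_weak_le a b phi -> sigma_weak_le a' b' phi.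
Proof.
move=> aa bb [xi [eta [xia etab phiP]]]; exists xi, eta; split=> // n.
  exact: le_trans aa.
exact: le_trans bb.
Qed.

(** Scaling the two families of vectors separately shifts weight between their square sums; when
    [c * d^* = 1] the functional stays the same. *)
Lemma sigma_weak_leZ H (a b c d : R[i]) (phi : 'B(H) -> R[i]) :
  sigma_weak_le a b phi ->
  sigma_weak_le (`|c| ^+ 2 * a) (`|d| ^+ 2 * b) (fun T => c * d^* * phi T).
Proof.
move=> [xi [eta [xia etab phiP]]].
exists (fun k => c *: xi k), (fun k => d *: eta k); split=> [n|n|T].
- under eq_bigr do rewrite normrZ exprMn.
  by rewrite -mulr_sumr ler_wpM2l// exprn_ge0.
- under eq_bigr do rewrite normrZ exprMn.
  by rewrite -mulr_sumr ler_wpM2l// exprn_ge0.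
- have -> : (fun k => ⟨T (c *: xi k), d *: eta k⟩ : R[i]^o) =
      (fun k => c * d^* * ⟨T (xi k), eta k⟩).
    by apply/funext => k; rewrite linearZ/= hdotZl hdotZr mulrA.
  have -> : series (fun k => c * d^* * ⟨T (xi k), eta k⟩ : R[i]^o) =
      (fun n => (c * d^* : R[i]^o) *: series (fun k => ⟨T (xi k), eta k⟩ : R[i]^o) n).
    by apply/funext => n; rewrite !seriesEnat /= -mulr_sumr.
  by apply: cvgZr; exact: phiP.
Qed.

(** A single index enumerates the pairs [(k, i)]. Cauchy-Schwarz together with
    [a * b <= a ^ 2 + b ^ 2] makes the double series absolutely summable, so it may be
    rearranged. *)
Lemma sigma_weak_le_series H (a b : nat -> R[i]) (M M' : R[i])
    (phi : nat -> 'B(H) -> R[i]) (psi : 'B(H) -> R[i]) :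
  (forall k, sigma_weak_le (a k) (b k) (phi k)) ->
  (forall n, \sum_(k < n) a k <= M) -> (forall n, \sum_(k < n) b k <= M') ->
  (forall T, series (fun k => phi k T : R[i]^o) @ \oo --> (psi T : R[i]^o)) ->
  sigma_weak_le M M' psi.
Proof.
move=> /choice[xi /choice[eta phiP]] aM bM psiP.
have sqM (F : seq (nat * nat)) : uniq F -> \sum_(p <- F) `|xi p.1 p.2| ^+ 2 <= M.
  apply: (sum_seq_pairs_le (g := fun k i => `|xi k i| ^+ 2) _ _ aM) => [k i|k n].
    by rewrite exprn_ge0.
  by have [] := phiP k.
have sqM' (F : seq (nat * nat)) : uniq F -> \sum_(p <- F) `|eta p.1 p.2| ^+ 2 <= M'.
  apply: (sum_seq_pairs_le (g := fun k i => `|eta k i| ^+ 2) _ _ bM) => [k i|k n].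
    by rewrite exprn_ge0.
  by have [] := phiP k.
have sq (z : nat -> nat -> H) n : `|decode_seq z n| ^+ 2 =
    decode_seq (fun k i => `|z k i| ^+ 2) n.
  by rewrite /decode_seq; case: pickle_inv => //=; rewrite normr0 expr0n.
exists (decode_seq xi), (decode_seq eta); split=> [n|n|T].
- under eq_bigr do rewrite sq.
  by rewrite sum_decode_seq; apply/sqM/decoded_uniq.
- under eq_bigr do rewrite sq.
  by rewrite sum_decode_seq; apply/sqM'/decoded_uniq.
have -> : (fun k => ⟨T (decode_seq xi k), decode_seq eta k⟩ : R[i]^o) =
    decode_seq (fun k i => ⟨T (xi k i), eta k i⟩).
  by apply/funext => n; rewrite /decode_seq; case: pickle_inv => //=; rewrite hdot0r.
have [N N0 TN] := bop_bounded T.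
apply: (cvg_decode_series (s := fun k => phi k T) (G := N * (M + M'))).
- move=> F uF; apply: (@le_trans _ _ (\sum_(p <- F) N *
    (`|xi p.1 p.2| ^+ 2 + `|eta p.1 p.2| ^+ 2))).
    apply: ler_sum => -[k i] _ /=; rewrite (le_trans (hdot_CS _ _))//.
    apply: (@le_trans _ _ (N * (`|xi k i| * `|eta k i|))).
      by rewrite mulrA ler_wpM2r.
    rewrite ler_wpM2l// -subr_ge0.
    have -> : `|xi k i| ^+ 2 + `|eta k i| ^+ 2 - `|xi k i| * `|eta k i| =
      (`|xi k i| - `|eta k i|) ^+ 2 + `|xi k i| * `|eta k i| by ring.
    apply: addr_ge0; last exact: mulr_ge0.
    by rewrite real_exprn_even_ge0// realB// normr_real.
  by rewrite -mulr_sumr big_split/= ler_wpM2l// lerD ?sqM ?sqM'.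
- by move=> k; have [] := phiP k.
- exact: psiP.
Qed.

(** Turns finite families into sequences, the form required of generators. *)
Definition pad (V : zmodType) m (f : 'I_m -> V) (k : nat) : V := oapp f 0 (insub k).

Lemma sum_pad (V : zmodType) m (f : 'I_m -> V) n : (m <= n)%N ->
  \sum_(k < n) pad f k = \sum_(i < m) f i.
Proof.
move=> mn; transitivity (\sum_(k < n | (k < m)%N) pad f k).
  rewrite [LHS](bigID (fun k : 'I_n => (k < m)%N))/= [X in _ + X]big1 ?addr0//.
  by move=> k km; rewrite /pad insubN.
by rewrite -big_ord_widen//; apply: eq_bigr => i _; rewrite /pad valK.
Qed.

Lemma sum_pad_le m (f : 'I_m -> R[i]) n : (forall i, 0 <= f i) ->
  \sum_(k < n) pad f k <= \sum_(i < m) f i.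
Proof.
move=> f0; have p0 k : 0 <= pad f k by rewrite /pad; case: insub.
rewrite -(sum_pad f (leq_addl n m)) big_split_ord/= lerDl.
by apply: sumr_ge0 => k _; exact: p0.
Qed.

Lemma cvg_series_pad m (f : 'I_m -> R[i]) :
  series (pad f : nat -> R[i]^o) @ \oo --> (\sum_(i < m) f i : R[i]^o).
Proof.
apply/cvgrPdist_lt => e e0; exists m => // n /= mn.
by rewrite seriesEnat /= big_mkord sum_pad// subrr normr0.
Qed.

Lemma sigma_weak_le_vec H m (x y : 'I_m -> H) :
  sigma_weak_le (\sum_i `|x i| ^+ 2) (\sum_i `|y i| ^+ 2)
    (fun T => \sum_i ⟨T (x i), y i⟩).
Proof.
have sq (z : 'I_m -> H) k : `|pad z k| ^+ 2 = pad (fun i => `|z i| ^+ 2) k.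
  by rewrite /pad; case: insub => //=; rewrite normr0 expr0n.
exists (pad x), (pad y); split=> [n|n|T].
- under eq_bigr do rewrite sq.
  by apply: sum_pad_le => i; rewrite exprn_ge0.
- under eq_bigr do rewrite sq.
  by apply: sum_pad_le => i; rewrite exprn_ge0.
have -> : (fun k => ⟨T (pad x k), pad y k⟩ : R[i]^o) =
    pad (fun i => ⟨T (x i), y i⟩).
  by apply/funext => k; rewrite /pad; case: insub => //=; rewrite hdot0r.
exact: cvg_series_pad.
Qed.

Lemma sigma_weak_generator_sum H m (c : 'I_m -> R[i]) (phi : 'I_m -> 'B(H) -> R[i]) :
  (forall i, sigma_weak_generator (phi i)) ->
  sigma_weak_generator (fun T => \sum_i c i * phi i T).
Proof.
move=> phiP; apply/sigma_weak_leP.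
have /choice[a /choice[b abP]] : forall i, exists a b, sigma_weak_le a b (phi i).
  by move=> i; apply/sigma_weak_leP.
have ge0 i : 0 <= a i /\ 0 <= b i.
  by have [xi [eta [/(_ 0%N) + /(_ 0%N) + _]]] := abP i; rewrite !big_ord0.
pose A i := `|c i| ^+ 2 * a i; pose B i := `|1 : R[i]| ^+ 2 * b i.
exists (\sum_i A i), (\sum_i B i).
apply: (@sigma_weak_le_series _ (pad A) (pad B) _ _
  (fun k T => pad (fun i => c i * phi i T) k)).
- move=> k; rewrite /pad; case: insubP => [i _ _|_] /=.
    have := sigma_weak_leZ (c i) 1 (abP i).
    by under eq_fun do rewrite conjC1 mulr1.
  (* Past the range the functional is zero; the empty family of vectors represents it with both
     bounds zero. *)
  have := @sigma_weak_le_vec H 0 (fun=> 0) (fun=> 0).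
  by rewrite !big_ord0; under eq_fun do rewrite big_ord0.
- by move=> n; apply: sum_pad_le => i; rewrite mulr_ge0 ?exprn_ge0// (ge0 i).1.
- by move=> n; apply: sum_pad_le => i; rewrite mulr_ge0 ?exprn_ge0// (ge0 i).2.
- by move=> T; exact: cvg_series_pad.
Qed.

Lemma sigma_weak_generator_linear H (phi : 'B(H) -> R[i]) :
  sigma_weak_generator phi -> scalar phi.
Proof.
move=> [xi [eta [_ _ phiP]]] a S T.
have : series (fun k => ⟨(a *: S + T) (xi k), eta k⟩ : R[i]^o) @ \oo -->
    (a * phi S + phi T : R[i]^o).
  have -> : series (fun k => ⟨(a *: S + T) (xi k), eta k⟩ : R[i]^o) =
      (fun n => (a : R[i]^o) *: series (fun k => ⟨S (xi k), eta k⟩ : R[i]^o) n +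
        series (fun k => ⟨T (xi k), eta k⟩ : R[i]^o) n).
    apply/funext => n; rewrite !seriesEnat /= scaler_sumr -big_split/=.
    by apply: eq_bigr => k _; rewrite hdotDl hdotZl.
  by apply: cvgD; [apply: cvgZr; exact: phiP|exact: phiP].
move=> h; exact: cvg_unique (phiP (a *: S + T)) h.
Qed.

End Generators.

(** * Normal functionals are themselves generators *)

(** Induction on [n]: subtracting a suitable multiple of [phi ord0] from [psi] gives a functional
    vanishing on the common kernel of the remaining ones. *)
Lemma scalar_lincomb (K : fieldType) (V : lmodType K) n (phi : 'I_n -> V -> K)
    (psi : V -> K) :
  (forall i, scalar (phi i)) -> scalar psi ->
  (forall v, (forall i, phi i v = 0) -> psi v = 0) ->
  exists c : 'I_n -> K, forall v, psi v = \sum_i c i * phi i v.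
Proof.
elim: n phi psi => [|n IH] phi psi phil psil ker.
  by exists (fun=> 0) => v; rewrite big_ord0; apply: ker => -[].
suff [d dP] : exists d, forall v, (forall i, phi (lift ord0 i) v = 0) ->
    psi v - d * phi ord0 v = 0.
  have [||c cP] := IH (fun i => phi (lift ord0 i)) (fun v => psi v - d * phi ord0 v) _ _ dP.
  - by move=> i; exact: phil.
  - by move=> a u v; rewrite psil phil; ring.
  exists (fun i => oapp c d (unlift ord0 i)) => v.
  rewrite big_ord_recl unlift_none /=; under eq_bigr do rewrite liftK /=.
  by rewrite -cP addrC subrK.
(* A vector [v0] killed by the other functionals but not by [phi ord0] determines the multiple. If
   there is none, [phi ord0] and hence [psi] vanish on their common kernel, and the multiple [0]
   works. *)
have [[v0 [v0P nz]]|none] := pselect (exists v0,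
    (forall i, phi (lift ord0 i) v0 = 0) /\ phi ord0 v0 != 0).
  exists (psi v0 / phi ord0 v0) => v vP.
  have := ker (- (phi ord0 v / phi ord0 v0) *: v0 + v).
  rewrite psil mulNr addrC => <-; first by field.
  move=> i; rewrite phil; case: (unliftP ord0 i) => [j|] ->.
    by rewrite v0P vP mulr0 addr0.
  by field.
exists 0 => v vP; rewrite mul0r subr0; apply: ker => i.
case: (unliftP ord0 i) => [j|] ->; first exact: vP.
by apply: contrapT => /eqP nz; apply: none; exists v.
Qed.

Section Normal.
Context {R : realType}.
Implicit Types H K : hilbertType R.

Lemma sigma_weak_generator_normal H (phi : 'B(H) -> R[i]) :
  sigma_weak_generator phi ->
  exists2 omega : {scalar 'B(H)}, normal_functional omega & omega =1 phi.
Proof.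
move=> phiP; pose pm := GRing.isLinear.Build _ _ _ _ phi (sigma_weak_generator_linear phiP).
pose omega : {scalar 'B(H)} := HB.pack phi pm.
exists omega => // e e0; exists 1%N, (fun=> phi), e; split=> // T.
by move=> /(_ ord0).
Qed.

(** On the common kernel of the [phi i], a linear subspace, [omega] is bounded by [1] and so
    vanishes; it is therefore a linear combination of the [phi i]. *)
Lemma normal_sigma_weak_generator H (omega : {scalar 'B(H)}) :
  normal_functional omega -> sigma_weak_generator omega.
Proof.
move=> /(_ 1 ltr01)[n [phi [d [d0 phiP dP]]]].
have [i||T T0|c cP] := @scalar_lincomb _ _ n phi omega.
- exact: sigma_weak_generator_linear (phiP i).
- exact: linearP.
- apply/eqP/negPn/negP => nz.
  have : `|omega ((omega T)^-1 *: T)| < 1.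
    apply: dP => i; have lin := sigma_weak_generator_linear (phiP i).
    have f0 : phi i 0 = 0.
      by have := lin (- 1) 0 0; rewrite scaleN1r oppr0 addr0 => ->; ring.
    by have := lin (omega T)^-1 T 0; rewrite !addr0 T0 f0 mulr0 addr0 => ->; rewrite normr0.
  by rewrite linearZ/= mulVf// normr1 ltxx.
have -> : (omega : 'B(H) -> R[i]) = (fun T => \sum_i c i * phi i T) by exact/funext.
exact: sigma_weak_generator_sum.
Qed.

End Normal.

(** * Functionals of the form [⟨(A ⊗ 1) u, v⟩] in the variable [A] *)

Section TensorVectors.
Context {R : realType}.
Implicit Types H K : hilbertType R.

Lemma adj_uniq H K (S : 'B(H, K)) (T : 'B(K, H)) :
  (forall x y, ⟨S x, y⟩ = ⟨x, T y⟩) -> S^† = T.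
Proof.
move=> ST; apply: bopE => y; apply: hdot_injl => z.
by rewrite hdotC -adjP ST -hdotC.
Qed.

Lemma adjPr H K (S : 'B(H, K)) x y : ⟨y, S x⟩ = ⟨S^† y, x⟩.
Proof. by rewrite hdotC adjP -hdotC. Qed.

Lemma adjK H K (S : 'B(H, K)) : S^†^† = S.
Proof. by apply: adj_uniq => x y; rewrite -adjPr. Qed.

(** The difference [w] is orthogonal to the span. Were it nonzero, some [s] in the span would
    satisfy [|w - s| < |w|], against [|w| ^ 2 = ⟨w - s, w⟩ <= |w - s| * |w|]. *)
Lemma hdot_dense_inj H (S : set H) (u u' : H) : dense (lspan S) ->
  (forall x, S x -> ⟨x, u⟩ = ⟨x, u'⟩) -> u = u'.
Proof.
move=> dS Su; apply/eqP; rewrite -subr_eq0; apply/negPn/negP.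
move Ew : (u - u') => w w0.
have Sw x : lspan S x -> ⟨x, w⟩ = 0.
  apply: (lspan_min (P := fun x => ⟨x, w⟩ = 0)) => [|a y z y0 z0|y /Su yu].
  - exact: hdot0l.
  - by rewrite hdotDl hdotZl y0 z0 mulr0 addr0.
  - by rewrite -Ew hdotBr yu subrr.
have wE : `|w| = (complex.Re `|w|)%:C%C by rewrite RRe_real// normr_real.
have w0' : 0 < complex.Re `|w| by rewrite -ltcR -wE normr_gt0.
have [s /Sw sw] := dense_approx dS w w0'; rewrite -wE; apply/negP.
rewrite real_ltNge ?normr_real// negbK -(ler_pM2r (x := `|w|)) ?normr_gt0//.
rewrite -expr2 -hdot_norm (le_trans _ (hdot_CS _ _))//.
by rewrite hdotBl sw subr0 hdot_norm ger0_norm// exprn_ge0.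
Qed.

(** Taking adjoints makes the simple tensors into test vectors, to which [hdot_dense_inj]
    applies. *)
Lemma bop_tens_eq H K L (T : hilbertTensor H K) (A B : 'B(T, L)) :
  (forall x y, A (x ⊗ y) = B (x ⊗ y)) -> A = B.
Proof.
move=> AB; rewrite -(adjK A) -(adjK B); congr (_^†).
apply: bopE => z; apply: (hdot_dense_inj (@tens_dense _ _ _ T)) => _ [[x y] _ <-].
by rewrite -!adjP AB.
Qed.

Lemma hdot_tensr H K (T : hilbertTensor H K) (y : K) (w : T) x :
  ⟨x ⊗ y, w⟩ = ⟨x, (tensr T y)^† w⟩.
Proof. by rewrite -adjP. Qed.

Lemma sum_geometric_le n : \sum_(k < n) (4%:R^-1 : R[i]) ^+ k <= 2%:R.
Proof.
(* The subtracted term strengthens the induction: at each step it drops by [3/2 * 4 ^- n], more than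
   the new summand [4 ^- n]. *)
suff h : \sum_(k < n) (4%:R^-1 : R[i]) ^+ k <= 2%:R - 2%:R * 4%:R^-1 ^+ n.
  by rewrite (le_trans h)// gerBl mulr_ge0// exprn_ge0// invr_ge0.
elim: n => [|n IH]; first by rewrite big_ord0 expr0 mulr1 subrr.
rewrite big_ord_recr/=; apply: (le_trans (lerD IH (lexx _))).
rewrite -subr_ge0 exprS.
set x := _ ^+ n; have -> : 2%:R - 2%:R * (4%:R^-1 * x) - (2%:R - 2%:R * x + x) = x / 2%:R.
  by field.
by rewrite divr_ge0// exprn_ge0// invr_ge0.
Qed.

Lemma geometric_lt (c e : R[i]) : 0 <= c -> 0 < e ->
  exists m, forall n, (m <= n)%N -> 4%:R^-1 ^+ n * c < e.
Proof.
move=> c0 e0.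
have cE : c = (complex.Re c)%:C%C by rewrite RRe_real// ger0_real.
have eE : e = (complex.Re e)%:C%C by rewrite RRe_real// gtr0_real.
have c0' : 0 <= complex.Re c by rewrite -ler0c -cE.
have e0' : 0 < complex.Re e by rewrite -ltcR -eE.
have [|m mP] := @exists_invn R (complex.Re e / (complex.Re c + 1)).
  by rewrite divr_gt0// ltr_wpDl.
exists m => n mn; rewrite {}cE {}eE.
have := mP n mn; rewrite ltr_pdivlMr ?ltr_wpDl// => h.
have -> : (4%:R^-1 : R[i]) ^+ n = (4%:R^-1 ^+ n : R)%:C%C.
  by rewrite rmorphXn/= fmorphV/= rmorph_nat.
rewrite -rmorphM ltcR; apply: le_lt_trans h.
apply: ler_pM => //; [by rewrite exprn_ge0// invr_ge0| |by rewrite lerDl].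
by rewrite exprVn lef_pV2 ?posrE ?exprn_gt0// -natrX ler_nat ltn_expl.
Qed.

(* Bessel's inequality, fibrewise *)
Lemma sum_adj_tensr_le H K (T : hilbertTensor H K) m (f : 'I_m -> K) (v : T) :
  (forall i j, ⟨f i, f j⟩ = (i == j)%:R) ->
  \sum_i `|(tensr T (f i))^† v| ^+ 2 <= `|v| ^+ 2.
Proof.
move=> ff; pose w := \sum_i (tensr T (f i))^† v ⊗ f i : T.
have wv : ⟨w, v⟩ = \sum_i `|(tensr T (f i))^† v| ^+ 2.
  by rewrite hdot_suml; apply: eq_bigr => i _; rewrite hdot_tensr hdot_norm.
have ww : ⟨w, w⟩ = ⟨w, v⟩.
  rewrite wv hdot_suml; apply: eq_bigr => i _; rewrite hdot_sumr (bigD1 i)//=.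
  rewrite big1 ?addr0; first by rewrite hdot_tens ff eqxx mulr1 hdot_norm.
  by move=> j /negPf ij; rewrite hdot_tens ff eq_sym ij mulr0.
have vw : ⟨v, w⟩ = ⟨w, v⟩.
  by rewrite hdotC -ww [in LHS]hdot_norm [in RHS]hdot_norm conj_Creal// rpredX// normr_real.
rewrite -wv -subr_ge0 -hdot_norm.
have -> : ⟨v, v⟩ - ⟨w, v⟩ = ⟨v - w, v - w⟩ by rewrite hdotBl !hdotBr vw ww; ring.
by rewrite hdot_norm exprn_ge0.
Qed.

(** Gram-Schmidt on the second legs writes [d] as the sum of [z j ⊗ f j] with [f] orthonormal. The
    square sum of the [z j] is then exactly [|d| ^ 2], and Bessel controls the contractions of [v]
    with the [f j]. *)
Lemma sigma_weak_le_alg_tens H K (T : hilbertTensor H K) (d v : T) :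
  lspan [set p.1 ⊗ p.2 | p in [set: H * K]] d ->
  sigma_weak_le (`|d| ^+ 2) (`|v| ^+ 2) (fun A => ⟨tensop T A 1 d, v⟩).
Proof.
move=> [n [c [w [wP ->]]]].
have /choice[p pw] : forall k, exists p : H * K, p.1 ⊗ p.2 = w k.
  by move=> k; have [p _ <-] := wP k; exists p.
have [m [f [a [ff yf]]]] := gram_schmidt (fun k => (p k).2).
pose z j := \sum_k (a k j * c k) *: (p k).1.
have -> : \sum_(i < n) c i *: w i = \sum_j z j ⊗ f j.
  transitivity (\sum_k \sum_j ((a k j * c k) *: (p k).1) ⊗ f j : T).
    apply: eq_bigr => k _; rewrite -pw yf tens_sumr scaler_sumr.
    by apply: eq_bigr => j _; rewrite tensZr tensZl scalerA mulrC.
  by rewrite exchange_big; apply: eq_bigr => j _ /=; rewrite /z tens_suml.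
have -> : `|\sum_j z j ⊗ f j : T| ^+ 2 = \sum_j `|z j| ^+ 2.
  rewrite -hdot_norm hdot_suml; apply: eq_bigr => j _.
  rewrite hdot_sumr (bigD1 j)//= big1 ?addr0.
    by rewrite hdot_tens ff eqxx mulr1 hdot_norm.
  by move=> i /negPf ij; rewrite hdot_tens ff eq_sym ij mulr0.
have -> : (fun A => ⟨tensop T A 1 (\sum_j z j ⊗ f j), v⟩) =
    (fun A : 'B(H) => \sum_j ⟨A (z j), (tensr T (f j))^† v⟩).
  apply/funext => A; rewrite linear_sum/= hdot_suml; apply: eq_bigr => j _.
  by rewrite tensopE hdot_tensr.
apply: sigma_weak_le_trans (sigma_weak_le_vec _ _) => //.
exact: sum_adj_tensr_le.
Qed.

(* [u] is the sum of a series of algebraic tensors [d k] with norms of order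
   [4 ^- k]; the functionals attached to the [d k] are summed after moving a factor
   [2 ^+ k] from the right vectors to the left ones. *)
Lemma sigma_weak_le_tens H K (T : hilbertTensor H K) (u v : T) :
  sigma_weak_le (8%:R * `|u| ^+ 2) (2%:R * `|v| ^+ 2) (fun A => ⟨tensop T A 1 u, v⟩).
Proof.
pose q : R[i] := 4%:R^-1.
have q0 : 0 < q by rewrite invr_gt0.
have qn0 k : 0 <= q ^+ k by rewrite exprn_ge0// ltW.
have q1 : q <= 1 by rewrite invf_le1// ler1n.
pose D := lspan [set p.1 ⊗ p.2 | p in [set: H * K]] : set T.
have [s [s0 Ds su]] : exists s : nat -> T,
    [/\ s 0%N = 0, forall n, D (s n) & forall n, `|u - s n| <= q ^+ n * `|u|].
  have /choice[s sP] : forall n, exists s, D s /\ `|u - s| <= q ^+ n * `|u|.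
    move=> n; have [->|u0] := eqVneq u 0.
      by exists 0; split; [exact: lspan0|rewrite subr0 normr0 mulr0].
    have e0 : 0 < q ^+ n * `|u| by rewrite mulr_gt0 ?exprn_gt0 ?normr_gt0.
    have eE : q ^+ n * `|u| = (complex.Re (q ^+ n * `|u|))%:C%C.
      by rewrite RRe_real// gtr0_real.
    have [|s Ds us] := dense_approx (@tens_dense _ _ _ T) u (e := complex.Re (q ^+ n * `|u|)).
      by rewrite -ltcR -eE.
    by exists s; rewrite eE ltW.
  (* Starting at [0] makes the differences [d k] telescope exactly to [s n]. *)
  exists (fun n => if n is 0 then 0 else s n); split=> // -[|n].
  - exact: lspan0.
  - exact: (sP _).1.
  - by rewrite expr0 mul1r subr0.
  - exact: (sP _).2.
pose d n := s n.+1 - s n.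
have dP n : D (d n).
  by rewrite /d -scaleN1r addrC; apply: lspanP; exact: Ds.
have dq n : `|d n| <= 2%:R * q ^+ n * `|u|.
  have -> : d n = (u - s n) - (u - s n.+1) by rewrite /d opprB [RHS]addrC addrA subrK.
  rewrite (le_trans (ler_normB _ _))// mulr2n !mulrDl mul1r lerD//.
  rewrite (le_trans (su _))// ler_wpM2r// exprS ler_piMl//.
have sd n : \sum_(k < n) d k = s n.
  elim: n => [|n IH]; first by rewrite big_ord0 s0.
  by rewrite big_ord_recr/= IH /d addrC subrK.
(* Since [|d k| <= 2 * q ^ k * |u|], the factor [2 ^ k] leads to these bounds, both of order
   [q ^ k]. The powers of [q] sum to at most [2], whence the totals [8 * |u| ^ 2] and
   [2 * |v| ^ 2]. *)
apply: (@sigma_weak_le_series _ _ (fun k => 4%:R * `|u| ^+ 2 * q ^+ k)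
  (fun k => `|v| ^+ 2 * q ^+ k) _ _ (fun k A => ⟨tensop T A 1 (d k), v⟩)).
- move=> k; have := sigma_weak_leZ (2%:R ^+ k) (2%:R ^- k) (sigma_weak_le_alg_tens v (dP k)).
  have -> : (fun A => 2%:R ^+ k * (2%:R ^- k)^* * ⟨tensop T A 1 (d k), v⟩) =
    (fun A => ⟨tensop T A 1 (d k), v⟩).
    apply/funext => A; rewrite conj_Creal ?rpredV ?rpredX ?realn//.
    by rewrite mulfV ?mul1r// expf_neq0// pnatr_eq0.
  apply: sigma_weak_le_trans.
    rewrite normrX normr_nat -exprM mulnC exprM.
    have -> : 4%:R * `|u| ^+ 2 * q ^+ k = (2%:R ^+ 2) ^+ k * (2%:R * q ^+ k * `|u|) ^+ 2.
      have -> : (2%:R ^+ 2 : R[i]) ^+ k = q ^- k by rewrite exprVn invrK -natrX.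
      rewrite !exprMn -natrX; field.
      by rewrite expf_neq0// gt_eqF.
    by rewrite ler_wpM2l ?exprn_ge0// ler_sqr ?nnegrE ?mulr_ge0.
  rewrite normfV normrX normr_nat -exprVn -exprM mulnC exprM exprVn.
  by rewrite mulrC -natrX.
- move=> n; rewrite -mulr_sumr.
  have -> : 8%:R * `|u| ^+ 2 = 4%:R * `|u| ^+ 2 * 2%:R by ring.
  by rewrite ler_wpM2l ?sum_geometric_le// mulr_ge0// exprn_ge0.
- move=> n; rewrite -mulr_sumr [leRHS]mulrC ler_wpM2l ?sum_geometric_le//.
  by rewrite exprn_ge0.
- move=> A; apply/cvgrPdist_lt => e e0.
  have [N N0 AN] := bop_bounded (tensop T A 1).
  pose c := N * `|u| * `|v|.
  have c0 : 0 <= c by rewrite !mulr_ge0.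
  have [m mP] := geometric_lt c0 e0.
  exists m => // n /= mn; rewrite seriesEnat /= big_mkord.
  rewrite -hdot_suml -linear_sum sd -hdotBl -linearB.
  apply: le_lt_trans (mP _ mn); rewrite (le_trans (hdot_CS _ _))//.
  rewrite /c mulrA ler_wpM2r// (le_trans (AN _))// mulrCA ler_wpM2l//.
Qed.

End TensorVectors.

(** * Products of slices *)

Section SliceAlgebra.
Context {R : realType} {H : hilbertType R}.

(** Expanding [omega] and then [omega'] gives a double series of functionals handled by
    [sigma_weak_le_tens], with bounds summable because [U] is bounded. Two realisations occur since
    for left slices [A] acts on the second leg, which is the first leg of a flipped [T], while the
    functionals keep the order of [T']. *)
Lemma sigma_weak_generator_tens2 (T T' : hilbertTensor H H) (U : 'B(T', T))
    (omega omega' : {scalar 'B(H)}) :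
  normal_functional omega -> normal_functional omega' ->
  sigma_weak_generator (fun A : 'B(H) =>
    omega (slice_r omega' (bop_comp U^† (bop_comp (tensop T A 1) U) : 'B(T')))).
Proof.
move=> no no'.
have [xi [eta [[M xiM] [N etaN] oP]]] := normal_sigma_weak_generator no.
have [xi' [eta' [[M' xiM'] [N' etaN'] oP']]] := normal_sigma_weak_generator no'.
have [B B0 UB] : exists2 B : R[i], 0 <= B & forall x, `|U x| <= B * `|x|.
  exact: bop_bounded.
have UB2 x y : `|U (x ⊗ y)| ^+ 2 <= B ^+ 2 * `|x| ^+ 2 * `|y| ^+ 2.
  rewrite -!exprMn ler_sqr ?nnegrE ?mulr_ge0//.
  by rewrite -mulrA -(norm_tens T').
have B8 : 0 <= 8%:R * B ^+ 2 by rewrite mulr_ge0// exprn_ge0.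
have B2 : 0 <= 2%:R * B ^+ 2 by rewrite mulr_ge0// exprn_ge0.
apply/sigma_weak_leP; exists (8%:R * B ^+ 2 * M * M'), (2%:R * B ^+ 2 * N * N').
pose X A : 'B(T') := bop_comp U^† (bop_comp (tensop T A 1) U).
have M'0 : 0 <= M' by have := xiM' 0%N; rewrite big_ord0.
have N'0 : 0 <= N' by have := etaN' 0%N; rewrite big_ord0.
apply: (@sigma_weak_le_series _ _ (fun k => 8%:R * B ^+ 2 * `|xi k| ^+ 2 * M')
  (fun k => 2%:R * B ^+ 2 * `|eta k| ^+ 2 * N') _ _
  (fun k A => omega' (vslice_l (xi k) (eta k) (X A)))).
- move=> k.
  apply: (@sigma_weak_le_series _ _
    (fun l => 8%:R * `|U (xi k ⊗ xi' l)| ^+ 2)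
    (fun l => 2%:R * `|U (eta k ⊗ eta' l)| ^+ 2) _ _
    (fun l A => ⟨tensop T A 1 (U (xi k ⊗ xi' l)), U (eta k ⊗ eta' l)⟩)).
  + by move=> l; exact: sigma_weak_le_tens.
  + move=> n; apply: (@le_trans _ _
      (\sum_(l < n) 8%:R * B ^+ 2 * `|xi k| ^+ 2 * `|xi' l| ^+ 2)).
      apply: ler_sum => l _; apply: (le_trans (ler_wpM2l _ (UB2 _ _))) => //.
      by rewrite !mulrA.
    by rewrite -mulr_sumr ler_wpM2l// mulr_ge0// exprn_ge0.
  + move=> n; apply: (@le_trans _ _
      (\sum_(l < n) 2%:R * B ^+ 2 * `|eta k| ^+ 2 * `|eta' l| ^+ 2)).
      apply: ler_sum => l _; apply: (le_trans (ler_wpM2l _ (UB2 _ _))) => //.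
      by rewrite !mulrA.
    by rewrite -mulr_sumr ler_wpM2l// mulr_ge0// exprn_ge0.
  + move=> A; suff -> : (fun l =>
        ⟨tensop T A 1 (U (xi k ⊗ xi' l)), U (eta k ⊗ eta' l)⟩ : R[i]^o) =
        (fun l => ⟨vslice_l (xi k) (eta k) (X A) (xi' l), eta' l⟩) by exact: oP'.
    apply/funext => l.
    by rewrite vslice_lP -[bop_fun (X A) _]/(U^† (tensop T A 1 (U _))) -adjPr.
- move=> n; rewrite -mulr_suml -mulr_sumr ler_wpM2r// ler_wpM2l//.
- move=> n; rewrite -mulr_suml -mulr_sumr ler_wpM2r// ler_wpM2l//.
- move=> A; suff -> : (fun k => omega' (vslice_l (xi k) (eta k) (X A)) : R[i]^o) =
      (fun k => ⟨slice_r omega' (X A) (xi k), eta k⟩) by exact: oP.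
  by apply/funext => k; rewrite slice_rP.
Qed.

(* The hypothesis is the pentagon equation read through vector functionals: the left
   side is [W_12 W_13], the right side [U_23^† W_12 U_23]. *)
Lemma slice_r_subalgebra (T T' : hilbertTensor H H) (U : 'B(T', T)) (W : 'B(T)) :
  (forall x p r y q s : H,
     ⟨W (x ⊗ r), (tensr T p)^† (W^† (y ⊗ q)) ⊗ s⟩ =
     ⟨tensop T (vslice_l x y W) 1 (U (p ⊗ r)), U (q ⊗ s)⟩) ->
  is_subalgebra (lspan [set slice_r omega W | omega in @normal_functional R H]).
Proof.
move=> WU; split; [exact: lspan0|by move=> a S S'; exact: lspanP|].
set A := lspan _.
have mulA omega omega' : normal_functional omega -> normal_functional omega' ->
    A (slice_r omega W * slice_r omega' W).
  move=> no no'; apply: lspan_sub.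
  have [theta nt thetaE] :=
    sigma_weak_generator_normal (sigma_weak_generator_tens2 U no no').
  (* Matrix coefficients are compared at [x, y], then at [p, q] once [omega] is removed, then at
     [r, s] once [omega'] is removed; the hypothesis remains. *)
  exists theta => //; apply: bopE => x; apply: hdot_injl => y.
  rewrite slice_rP// thetaE -[bop_fun (_ * _) x]/(slice_r omega W (slice_r omega' W x)).
  rewrite slice_rP//; congr (omega _).
  apply: bopE => p; apply: hdot_injl => q.
  rewrite slice_rP// vslice_lP adjP hdot_tensr slice_rP//; congr (omega' _).
  apply: bopE => r; apply: hdot_injl => s; rewrite !vslice_lP WU.
  by rewrite -[bop_fun _ (p ⊗ r)]/(U^† (tensop T _ 1 (U _))) -adjPr.
move=> S S' AS AS'; move: S AS; apply: lspan_min => [|a B B' AB AB'|_ [omega no <-]] /=.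
- by rewrite mul0r; exact: lspan0.
- have -> : (a *: B + B') * S' = a *: (B * S') + B' * S' by exact: bopE.
  exact: lspanP.
move: S' AS'; apply: lspan_min => [|a B B' AB AB'|_ [omega' no' <-]] /=.
- by rewrite mulr0; exact: lspan0.
- have -> : slice_r omega W * (a *: B + B') =
      a *: (slice_r omega W * B) + slice_r omega W * B'.
    by apply: bopE => x; rewrite -[LHS]/(slice_r omega W (a *: B x + B' x)) linearP.
  exact: lspanP.
exact: mulA.
Qed.

End SliceAlgebra.

(** * Matrix coefficients of the leg operators *)

Section LegIdentities.
Context {R : realType} {H : hilbertType R}.
Context {H2 : hilbertTensor H H} (H3 : hilbertTensor H2 H).

Lemma bop_tens3_eq L (A B : 'B(H3, L)) :
  (forall x y z, A ((x ⊗ y : H2) ⊗ z) = B ((x ⊗ y : H2) ⊗ z)) -> A = B.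
Proof.
move=> AB; rewrite -(adjK A) -(adjK B); congr (_^†).
apply: bopE => w; apply: (hdot_dense_inj (@tens3_dense _ _ _ H3)) => _ [[[x y] z] _ <-].
by rewrite -!adjP AB.
Qed.

Lemma flip12E x y z : flip12 H3 ((x ⊗ y : H2) ⊗ z) = (y ⊗ x : H2) ⊗ z.
Proof. by rewrite /flip12 tensopE flipE. Qed.

Lemma flip12K (w : H3) : flip12 H3 (flip12 H3 w) = w.
Proof.
suff e : flip12 H3 * flip12 H3 = 1 by have := congr1 (fun S : 'B(H3) => S w) e.
apply: bop_tens3_eq => x y z.
by rewrite -[LHS]/(flip12 H3 (flip12 H3 _)) !flip12E.
Qed.

Lemma flip23K (w : H3) : flip23 H3 (flip23 H3 w) = w.
Proof.
suff e : flip23 H3 * flip23 H3 = 1 by have := congr1 (fun S : 'B(H3) => S w) e.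
apply: bop_tens3_eq => x y z.
by rewrite -[LHS]/(flip23 H3 (flip23 H3 _)) !flip23E.
Qed.

Lemma tens3_adj (S T : 'B(H3)) :
  (forall x y z x' y' z', ⟨S ((x ⊗ y : H2) ⊗ z), (x' ⊗ y' : H2) ⊗ z'⟩ =
     ⟨(x ⊗ y : H2) ⊗ z, T ((x' ⊗ y' : H2) ⊗ z')⟩) -> S^† = T.
Proof.
move=> ST; apply: bop_tens3_eq => x' y' z'.
apply: (hdot_dense_inj (@tens3_dense _ _ _ H3)) => _ [[[x y] z] _ <-] /=.
by rewrite -adjP ST.
Qed.

Lemma flip12_adj : (flip12 H3)^† = flip12 H3.
Proof. by apply: tens3_adj => *; rewrite !flip12E !hdot_tens; ring. Qed.

Lemma flip23_adj : (flip23 H3)^† = flip23 H3.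
Proof. by apply: tens3_adj => *; rewrite !flip23E !hdot_tens; ring. Qed.

Lemma leg12_adj (W : 'B(H2)) : (leg12 H3 W)^† = leg12 H3 W^†.
Proof. by apply: tens3_adj => *; rewrite /leg12 !tensopE !hdot_tens adjP. Qed.

Lemma leg23_adj (W : 'B(H2)) : (leg23 H3 W)^† = leg23 H3 W^†.
Proof.
apply: adj_uniq => u v.
rewrite -[bop_fun (leg23 H3 W) u]/(flip12 H3 (flip23 H3 (leg12 H3 W (flip23 H3 (flip12 H3 u))))).
rewrite adjP flip12_adj adjP flip23_adj adjP leg12_adj adjP flip23_adj adjP flip12_adj.
by [].
Qed.

(* [x ⊗ w], under the identification of [H ⊗ H2] with [H3 = H2 ⊗ H] *)
Definition tens1 (x : H) : 'B(H2, H3) :=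
  bop_comp (flip12 H3) (bop_comp (flip23 H3) (tensr H3 x)).

Lemma tens1E x y z : tens1 x (y ⊗ z) = (x ⊗ y : H2) ⊗ z.
Proof. by rewrite -[LHS]/(flip12 H3 (flip23 H3 ((y ⊗ z) ⊗ x))) flip23E flip12E. Qed.

Lemma hdot_tens1 x y (u v : H2) : ⟨tens1 x u, tens1 y v⟩ = ⟨x, y⟩ * ⟨u, v⟩.
Proof.
rewrite -[bop_fun (tens1 x) u]/(flip12 H3 (flip23 H3 (u ⊗ x))).
rewrite adjP flip12_adj -[bop_fun (tens1 y) v]/(flip12 H3 (flip23 H3 (v ⊗ y))) flip12K.
by rewrite adjP flip23_adj flip23K hdot_tens mulrC.
Qed.

(** The flips defining [leg23] cancel those defining [tens1]. *)
Lemma leg23_tens1 (W : 'B(H2)) x w : leg23 H3 W (tens1 x w) = tens1 x (W w).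
Proof.
rewrite -[LHS]/(flip12 H3 (flip23 H3 (leg12 H3 W (flip23 H3 (flip12 H3
  (flip12 H3 (flip23 H3 (w ⊗ x)))))))).
by rewrite flip12K flip23K /leg12 tensopE.
Qed.

Lemma leg13_flip23 (W : 'B(H2)) (w : H2) z :
  leg13 H3 W (flip23 H3 (w ⊗ z)) = flip23 H3 (W w ⊗ z).
Proof.
rewrite -[LHS]/(flip23 H3 (leg12 H3 W (flip23 H3 (flip23 H3 (w ⊗ z))))).
by rewrite flip23K /leg12 tensopE.
Qed.

Lemma leg13E (W : 'B(H2)) x y z :
  leg13 H3 W ((x ⊗ y : H2) ⊗ z) = flip23 H3 (W (x ⊗ z) ⊗ y).
Proof. by rewrite -(flip23E H3) leg13_flip23. Qed.

Lemma hdot_tens_eq2 (S S' : 'B(H2)) :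
  (forall x y x' y', ⟨S (x ⊗ y), (x' ⊗ y' : H2)⟩ = ⟨S' (x ⊗ y), (x' ⊗ y' : H2)⟩) ->
  S = S'.
Proof.
move=> SS; apply: bop_tens_eq => x y.
apply: (hdot_dense_inj (@tens_dense _ _ _ H2)) => _ [[x' y'] _ <-] /=.
by rewrite hdotC SS -hdotC.
Qed.

(** With the first leg fixed, both sides factor on simple tensors, the third leg contributing only
    an inner product. Right slices use this for the conjugated side of the pentagon equation. *)
Lemma leg12_tens1 (W : 'B(H2)) x y u v :
  ⟨leg12 H3 W (tens1 x u), tens1 y v⟩ = ⟨tensop H2 (vslice_l x y W) 1 u, v⟩.
Proof.
suff e : bop_comp (tens1 y)^† (bop_comp (leg12 H3 W) (tens1 x)) =
    tensop H2 (vslice_l x y W) 1.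
  by rewrite -e; exact: (adjPr (tens1 y)).
apply: hdot_tens_eq2 => p r q s.
rewrite -[bop_fun (bop_comp _ _) _]/((tens1 y)^† (leg12 H3 W (tens1 x (p ⊗ r)))).
rewrite adjP adjK !tens1E /leg12 tensopE !hdot_tens tensopE hdot_tens.
by rewrite vslice_lP.
Qed.

(** Moving [W_12] to the right side leaves [p], untouched by [W_13], to be contracted with
    [W^† (y ⊗ q)]. *)
Lemma leg12_leg13_hdot (W : 'B(H2)) x p r y q s :
  ⟨leg12 H3 W (leg13 H3 W ((x ⊗ p : H2) ⊗ r)), (y ⊗ q : H2) ⊗ s⟩ =
  ⟨W (x ⊗ r), (tensr H2 p)^† (W^† (y ⊗ q)) ⊗ s⟩.
Proof.
(* For arbitrary [w] both sides are inner products of [w] with fixed vectors, which are compared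
   against simple tensors. *)
rewrite leg13E; move: (W (x ⊗ r)) => w.
rewrite -[flip23 H3 (w ⊗ p)]/((bop_comp (flip23 H3) (tensr H3 p)) w) adjP adjP.
congr hdot; apply: (hdot_dense_inj (@tens_dense _ _ _ H2)) => _ [[a b] _ <-] /=.
rewrite -adjP -[bop_fun (bop_comp _ _) _]/(flip23 H3 ((a ⊗ b) ⊗ p)) flip23E -adjP.
by rewrite /leg12 tensopE !hdot_tens -hdot_tensr -adjP.
Qed.

(** The same comparison of vectors paired with [w]; left slices use it with [w = W (r ⊗ x)]. *)
Lemma leg13_tens1_hdot (W : 'B(H2)) p w q s y :
  ⟨leg13 H3 W (tens1 p w), (q ⊗ s : H2) ⊗ y⟩ =
  ⟨w, s ⊗ (tensl H2 p)^† (W^† (q ⊗ y))⟩.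
Proof.
rewrite adjP adjP; congr hdot.
apply: (hdot_dense_inj (@tens_dense _ _ _ H2)) => _ [[a b] _ <-] /=.
rewrite -adjP tens1E -adjP leg13E adjP flip23_adj flip23E !hdot_tens -!adjP.
by rewrite mulrC.
Qed.

Lemma leg23_hdot (W : 'B(H2)) x y u v :
  ⟨leg23 H3 W (u ⊗ x), v ⊗ y⟩ = ⟨tensop H2 1 (vslice_r x y W) u, v⟩.
Proof.
suff e : bop_comp (tensr H3 y)^† (bop_comp (leg23 H3 W) (tensr H3 x)) =
    tensop H2 1 (vslice_r x y W).
  by rewrite -e; exact: (adjPr (tensr H3 y)).
apply: hdot_tens_eq2 => p r q s.
rewrite -[bop_fun (bop_comp _ _) _]/((tensr H3 y)^† (leg23 H3 W ((p ⊗ r) ⊗ x))).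
rewrite adjP adjK -[bop_fun (tensr H3 y) _]/((q ⊗ s : H2) ⊗ y) -!tens1E leg23_tens1.
by rewrite hdot_tens1 tensopE hdot_tens vslice_rP.
Qed.

End LegIdentities.

(** * Exchange of legs, and the two subalgebras *)

(** Reduces left slices to right slices, so that [slice_r_subalgebra] serves both. *)
Lemma slice_l_swap (R : realType) (H : hilbertType R) (T : hilbertTensor H H)
    (omega : {scalar 'B(H)}) (W : 'B(T)) : normal_functional omega ->
  slice_l omega W = @slice_r _ _ _ (tens_swap T) omega W.
Proof.
move=> no; apply: bopE => x; apply: hdot_injl => y; rewrite slice_lP// slice_rP//.
congr (omega _); apply: bopE => p; apply: hdot_injl => q.
by rewrite vslice_rP.
Qed.

Theorem proposition1p3 (R : realType) (H : hilbertType R)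
    (H2 : hilbertTensor H H) (H3 : hilbertTensor H2 H) (W : 'B(H2)) :
  multiplicative_partial_isometry H3 W ->
  is_subalgebra (lspan [set slice_r omega W | omega in @normal_functional R H]) /\
  is_subalgebra (lspan [set slice_l omega W | omega in @normal_functional R H]).
Proof.
move=> [_ pent pent' _ _]; split.
  (* With [U = W^†], [U^† (A ⊗ 1) U] is the [W (A ⊗ 1) W^†] of the first pentagon equation. *)
  apply: (@slice_r_subalgebra _ _ H2 H2 W^†) => x p r y q s.
  rewrite -(leg12_leg13_hdot H3) -[bop_fun (leg12 H3 W) _]/((leg12 H3 W * leg13 H3 W) _) -pent.
  rewrite -[bop_fun (_ * _) _]/(leg23 H3 W (leg12 H3 W ((leg23 H3 W)^† ((x ⊗ p) ⊗ r)))).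
  by rewrite adjP leg23_adj -!tens1E !leg23_tens1 leg12_tens1.
have -> : [set slice_l omega W | omega in @normal_functional R H] =
    [set @slice_r _ _ _ (tens_swap H2) omega W | omega in @normal_functional R H].
  by apply/seteqP; split=> _ [omega no <-]; exists omega => //; rewrite slice_l_swap.
(* In the flipped realisation [A ⊗ 1] is [1 ⊗ A] on [H2], so [U = W] gives [W^† (1 ⊗ A) W]. *)
apply: (@slice_r_subalgebra _ _ (tens_swap H2) H2 W) => x p r y q s.
(* [tensop] is chosen by its values on simple tensors, so the flipped and unflipped operators have
   to be identified there. *)
have -> : tensop (tens_swap H2) (@vslice_l _ _ _ (tens_swap H2) x y W) 1 =
    tensop H2 1 (vslice_r x y W) :> 'B(H2).
  apply: hdot_tens_eq2 => a b c d; rewrite [in RHS]tensopE.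
  have -> : tensop (tens_swap H2) (@vslice_l _ _ _ (tens_swap H2) x y W) 1 (a ⊗ b : H2) =
      @tens _ _ _ H2 a (@vslice_l _ _ _ (tens_swap H2) x y W b).
    exact: (@tensopE _ _ _ (tens_swap H2) _ 1 b a).
  by rewrite !hdot_tens.
rewrite -(leg23_hdot H3).
(* [W (p ⊗ r) ⊗ x] is [W_12] applied to a simple tensor, so this is a coefficient of
   [W_12^† W_23 W_12], to which the second pentagon equation applies. *)
have -> : ⟨leg23 H3 W (W (p ⊗ r) ⊗ x), W (q ⊗ s) ⊗ y⟩ =
    ⟨leg13 H3 W (leg23 H3 W ((p ⊗ r) ⊗ x)), (q ⊗ s) ⊗ y⟩.
  rewrite -[bop_fun (leg13 H3 W) _]/((leg13 H3 W * leg23 H3 W) _) -pent'.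
  rewrite -[bop_fun (_ * _) _]/((leg12 H3 W)^† (leg23 H3 W (leg12 H3 W ((p ⊗ r) ⊗ x)))).
  by rewrite [RHS]adjP adjK /leg12 !tensopE.
by rewrite -tens1E leg23_tens1 leg13_tens1_hdot.
Qed.
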